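(* For every integer $r\geq 1$, the $\mathbb{F}_p$-linear map $\widehat{E}_r:\mathcal{R}\to\mathcal{O}(\Omega^r)$ determined by $\widehat{E}_r(1)=1$ and $\widehat{E}_r(x_{\underline{a}})=E_r(\underline{a};\mathbf{z})$ for every non-empty index $\underline{a}$ is an $\mathbb{F}_p$-algebra homomorphism from $(\mathcal{R},\ast)$ to $\mathcal{O}(\Omega^r)$; i.e., for all indices $\underline{a},\underline{b}$, \[ \widehat{E}_r(x_{\underline{a}}\ast x_{\underline{b}})=E_r(\underline{a};\mathbf{z})\,E_r(\underline{b};\mathbf{z}). \]
   Context: Basic notation. $p$ is a prime, $q$ a power of $p$, $A=\mathbb{F}_q[\theta]$, $K=\mathbb{F}_q(\theta)$, $K_\infty$ is the completion of $K$ at the infinite place with absolute value normalized by $|\theta|=q$, and $\mathbb{C}_\infty$ is the completion of an algebraic closure of $K_\infty$. $A_+$ is the set of monic polynomials in $A$. $\mathbb{N}$ is the set of positive integers. An index is a finite (possibly empty) tuple $\underline{a}=(a_1,\ldots,a_m)\in\mathbb{N}^m$. Drinfeld symmetric space. For $r\ge1$, $\Omega^r=\{\mathbf{z}=(z_1,\ldots,z_r)\in\mathbb{C}_\infty^r : z_1,\ldots,z_r \text{ are } K_\infty\text{-linearly independent and } z_r=1\}$. For a $K_\infty$-rational hyperplane $H$ of $\mathbb{P}^{r-1}(\mathbb{C}_\infty)$ let $\ell_H=c_1X_1+\cdots+c_rX_r\in K_\infty[X_1,\ldots,X_r]$ be a defining linear form with $\max_i|c_i|=1$; put $|\mathbf{z}|=\max_i|z_i|$,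 $h(\mathbf{z})=|\mathbf{z}|^{-1}\inf_H|\ell_H(\mathbf{z})|$, and $\Omega^r_n=\{\mathbf{z}\in\Omega^r: h(\mathbf{z})\ge q^{-n}\}$ for $n\in\mathbb{N}$, so $\Omega^r=\bigcup_n\Omega^r_n$. A function $\Omega^r\to\mathbb{C}_\infty$ is rigid analytic if its restriction to each $\Omega_n^r$ is a uniform limit of rational functions without poles on $\Omega^r_n$. $\mathcal{O}(\Omega^r)$ is the algebra of rigid analytic functions on $\Omega^r$ (pointwise operations). Order. For $\boldsymbol{f}=(f_1,\ldots,f_r)\in A^r$ and $\mathbf{z}\in\Omega^r$ put $\langle\boldsymbol{f},\mathbf{z}\rangle=\sum_i f_iz_i$. Define $\langle\boldsymbol{f},\mathbf{z}\rangle\succ0$ if $f_1=\cdots=f_{i-1}=0$ and $f_i\in A_+$ for some $1\le i\le r$. For $\langle\boldsymbol{f},\mathbf{z}\rangle,\langle\boldsymbol{g},\mathbf{z}\rangle\succ0$, write $\langle\boldsymbol{f},\mathbf{z}\rangle\succ\langle\boldsymbol{g},\mathbf{z}\rangle$ if there is $1\le i\le r$ with $f_1=\cdots=f_{i-1}=g_1=\cdots=g_{i-1}=0$ and either ($f_i,g_i\in A_+$ and $\deg f_i>\deg g_i$) or ($f_i\in A_+$ and $g_i=0$). Multiple Eisenstein series. For a non-empty index $\underline{a}=(a_1,\ldots,a_m)$ and $\mathbf{z}\in\Omega^r$, \[ E_r(\underline{a};\mathbf{z})=\sum_{\substack{\boldsymbol{f}_1,\ldots,\boldsymbol{f}_m\in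 A^r\\ \langle\boldsymbol{f}_1,\mathbf{z}\rangle\succ\cdots\succ\langle\boldsymbol{f}_m,\mathbf{z}\rangle\succ0}}\frac{1}{\langle\boldsymbol{f}_1,\mathbf{z}\rangle^{a_1}\cdots\langle\boldsymbol{f}_m,\mathbf{z}\rangle^{a_m}}, \] and $E_r(\emptyset;\mathbf{z})=1$. These are rigid analytic functions on $\Omega^r$. (For $r=1$, $\Omega^1=\{1\}$ and $E_1(\underline{a};1)$ is Thakur's multiple zeta value $\zeta_A(\underline{a})=\sum 1/(f_1^{a_1}\cdots f_m^{a_m})$ over $f_i\in A_+$ with $\deg f_1>\cdots>\deg f_m\ge0$.) The algebra $\mathcal{R}$. $\mathcal{R}$ is the $\mathbb{F}_p$-vector space with basis the free monoid on letters $\{x_k: k\in\mathbb{N}\}$; put $x_{\underline{a}}=x_{a_1}\cdots x_{a_m}$, $x_\emptyset=1$, and let $\underline{a}^{(1)}=(a_2,\ldots,a_m)$ ($=\emptyset$ if $m=1$). Juxtaposition denotes concatenation, extended linearly. For $i,j,a,b\in\mathbb{N}$ let $\Delta^{i,j}_{a,b}=(-1)^{a-1}\binom{j-1}{a-1}+(-1)^{b-1}\binom{j-1}{b-1}\in\mathbb{F}_p$. The $q$-shuffle product $\ast$ on $\mathcal{R}$ is the $\mathbb{F}_p$-bilinear product defined inductively on the sum of depths (word lengths) by $1\ast\mathfrak{a}=\mathfrak{a}\ast1=\mathfrak{a}$ and, for non-empty indices $\underline{a},\underline{b}$, \[ x_{\underline{a}}\ast x_{\underline{b}}=x_{a_1}(x_{\underline{a}^{(1)}}\ast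 x_{\underline{b}})+x_{b_1}(x_{\underline{a}}\ast x_{\underline{b}^{(1)}})+x_{a_1+b_1}(x_{\underline{a}^{(1)}}\ast x_{\underline{b}^{(1)}})+\sum_{\substack{i+j=a_1+b_1\\ q-1\mid j}}\Delta^{i,j}_{a_1,b_1}\,x_i\big((x_{\underline{a}^{(1)}}\ast x_{\underline{b}^{(1)}})\ast x_j\big), \] where the sum is over $i,j\in\mathbb{N}$. *)

(* Defs.v *)
From HB Require Import structures.
From mathcomp Require Import all_boot all_order all_algebra all_field.
From mathcomp Require Import finmap.
From mathcomp Require Import boolp classical_sets reals.
From mathcomp Require mpoly.
From mathcomp Require Import monalg.

Set Implicit Arguments.
Unset Strict Implicit.
Unset Printing Implicit Defensive.

Import Order.TTheory GRing.Theory Num.Theory.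

Local Open Scope fset_scope.
Local Open Scope ring_scope.
Local Open Scope quotient_scope.

Section Absolute_values.
Variable R : realType.

(* Non-archimedean absolute values.  They are plain functions because the
   normed structures of MathComp force characteristic 0. *)
Definition is_absval (L : fieldType) (v : L -> R) : Prop :=
  [/\ forall x, 0 <= v x,
      forall x, v x = 0 <-> x = 0,
      forall x y, v (x * y) = v x * v y
    & forall x y, v (x + y) <= Num.max (v x) (v y)].

Definition cauchy_seq (L : fieldType) (v : L -> R) (u : nat -> L) : Prop :=
  forall e : R, 0 < e -> exists N : nat, forall m n : nat,
    (N <= m)%N -> (N <= n)%N -> v (u m - u n) < e.

Definition seq_lim (L : fieldType) (v : L -> R) (u : nat -> L) (l : L) : Prop :=
  forall e : R, 0 < e -> exists N : nat, forall n : nat,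
    (N <= n)%N -> v (u n - l) < e.

Definition is_completion (L L' : fieldType) (v : L -> R) (v' : L' -> R)
    (i : {rmorphism L -> L'}) : Prop :=
  [/\ is_absval v',
      forall x, v' (i x) = v x,
      forall u, cauchy_seq v' u -> exists l, seq_lim v' u l
    & forall (y : L') (e : R), 0 < e -> exists x : L, v' (y - i x) < e].

Definition is_algebraic_closure (L L' : fieldType) (i : {rmorphism L -> L'}) :
    Prop :=
  GRing.closed_field_axiom L' /\ forall x : L', algebraicOver i x.

(* |f / g| = q ^ (deg f - deg g) *)
Definition absK (F : finFieldType) (x : {fraction {poly F}}) : R :=
  let u := repr x in
  if \n_u == 0 then 0
  else #|F|%:R ^+ (size \n_u).-1 / #|F|%:R ^+ (size \d_u).-1.

(* K_infty, an algebraic closure of it with the extended absolute value, and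
   C_infty.  These data are unique up to isometric isomorphism. *)
Record Cinf_model (F : finFieldType) := CinfModel {
  Kinf : fieldType;
  Kbar : fieldType;
  Cinf : fieldType;
  vKinf : Kinf -> R;
  vKbar : Kbar -> R;
  vC : Cinf -> R;
  iKinf : {rmorphism {fraction {poly F}} -> Kinf};
  iKbar : {rmorphism Kinf -> Kbar};
  iC : {rmorphism Kbar -> Cinf};
  Kinf_completion : is_completion (@absK F) vKinf iKinf;
  Kbar_closure : is_algebraic_closure iKbar;
  vKbar_absval : is_absval vKbar;
  vKbar_extends : forall x, vKbar (iKbar x) = vKinf x;
  Cinf_completion : is_completion vKbar vC iC }.

End Absolute_values.

Definition posnat := {n : nat | (0 < n)%N}.

Definition posn (k : nat) : posnat := insubd (exist _ 1%N isT : posnat) k.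

Definition mindex := seq posnat.

Section Eisenstein.
Variables (R : realType) (F : finFieldType) (M : Cinf_model R F) (r : nat).

Local Notation C := (Cinf M).
Local Notation K := (Kinf M).
Local Notation A := {poly F}.

Definition ofKinf (x : K) : C := iC M (iKbar M x).
Definition ofA (f : A) : C := ofKinf (iKinf M (FracField.tofrac f)).

Definition linform (c : 'rV[K]_r) (z : 'rV[C]_r) : C :=
  \sum_(i < r) ofKinf (c 0 i) * z 0 i.

(* The coordinates z_1, ..., z_r have ordinals 0, ..., r - 1. *)
Record Omega := MkOmega {
  coords :> 'rV[C]_r;
  coords_indep : forall c : 'rV[K]_r, linform c coords = 0 -> c = 0;
  coords_last : forall i : 'I_r, i.+1 = r -> coords 0 i = 1 }.

(* A K_infty-rational hyperplane is given by a linear form of norm 1, unique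
   up to a scalar of absolute value 1, which does not change |l_H(z)|. *)
Definition hdist (z : Omega) : R :=
  (\big[Num.max/0]_(i < r) vC (z 0 i))^-1 *
  inf [set d | exists c : 'rV[K]_r,
         \big[Num.max/0]_(i < r) vKinf (c 0 i) = 1 /\ d = vC (linform c z)]%classic.

Definition Omega_n (n : nat) (z : Omega) : Prop := #|F|%:R ^- n <= hdist z.

Definition peval (P : mpoly.mpoly r C) (z : Omega) : C :=
  mpoly.meval (fun i => z 0 i) P.

Definition rational_without_poles (n : nat) (g : Omega -> C) : Prop :=
  exists P Q : mpoly.mpoly r C, forall z : Omega, Omega_n n z ->
    peval Q z != 0 /\ g z = peval P z / peval Q z.

(* Membership in O(Omega^r) *)
Definition rigid_analytic (f : Omega -> C) : Prop :=
  forall n : nat, (0 < n)%N ->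
  exists g : nat -> Omega -> C,
    (forall k, rational_without_poles n (g k)) /\
    forall e : R, 0 < e -> exists N : nat, forall k : nat, (N <= k)%N ->
      forall z : Omega, Omega_n n z -> vC (f z - g k z) < e.

(* Unordered sums, along the finite subsets of an index type. *)
Definition has_sum (T : choiceType) (D : pred T) (u : T -> C) (s : C) : Prop :=
  forall e : R, 0 < e -> exists J0 : {fset T}, forall J : {fset T},
    J0 `<=` J -> vC (\sum_(t <- J | D t) u t - s) < e.

Definition infsum (T : choiceType) (D : pred T) (u : T -> C) : C :=
  xget 0 [set s | has_sum D u s]%classic.

Definition pairing (f : 'rV[A]_r) (z : Omega) : C :=
  \sum_(i < r) ofA (f 0 i) * z 0 i.

(* The relations <f, z> > 0 and <f, z> > <g, z> depend only on f and g. *)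
Definition succ0 (f : 'rV[A]_r) : bool :=
  [exists i : 'I_r,
    [forall j : 'I_r, (j < i)%N ==> (f 0 j == 0)] && (f 0 i \is monic)].

Definition succ (f g : 'rV[A]_r) : bool :=
  [&& succ0 f, succ0 g &
   [exists i : 'I_r,
    [forall j : 'I_r, (j < i)%N ==> (f 0 j == 0) && (g 0 j == 0)] &&
    ([&& f 0 i \is monic, g 0 i \is monic & (size (g 0%R i) < size (f 0%R i))%N]
     || (f 0 i \is monic) && (g 0 i == 0))]].

(* E_r(a; z), as a sum over the sequences (f_1, ..., f_m), m = size a. *)
Definition Eis (a : mindex) (z : Omega) : C :=
  if a is [::] then 1 else
  infsum (fun fs : seq 'rV[A]_r =>
            [&& size fs == size a, sorted succ fs & all succ0 fs])
         (fun fs => (\prod_(fa <- zip fs a) pairing fa.1 z ^+ val fa.2)^-1).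

End Eisenstein.

(* The ring multiplication of this type is the concatenation product. *)
Notation words p := {malg 'F_p[{fmonom posnat}]}.

Section Words.
Variable p : nat.
Local Notation words := (words p).

Definition xw (a : mindex) : words := << FMonom a >>.

(* x_k, for 0 < k; the junk value xl 0 is never used. *)
Definition xl (k : nat) : words := xw [:: posn k].

Definition wlin (V : lmodType 'F_p) (f : mindex -> V) (x : words) : V :=
  \sum_(w <- msupp x) x@_w *: f (fmonom_val w).

(* Delta^{i,j}_{a,b}, which does not depend on i *)
Definition Delta (j a b : nat) : 'F_p :=
  (-1) ^+ a.-1 * 'C(j.-1, a.-1)%:R + (-1) ^+ b.-1 * 'C(j.-1, b.-1)%:R.

Variable q : nat.

(* The q-shuffle product of two words, by recursion on a bound n for the sum
   of their depths; see qshuffle_rec below for the defining equation. *)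
Fixpoint qsh (n : nat) (u v : mindex) : words :=
  match n, u, v with
  | n'.+1, a :: u', b :: v' =>
      xw [:: a] * qsh n' u' v + xw [:: b] * qsh n' u v'
      + xl (val a + val b) * qsh n' u' v'
      + \sum_(1 <= j < val a + val b | (q.-1 %| j)%N)
          Delta j (val a) (val b) *:
          (xl (val a + val b - j) *
           wlin (fun w => qsh n' w [:: posn j])
                (qsh n' u' v'))
  | _, [::], _ => xw v
  | _, _, _ => xw u
  end.

Definition qshuffle (x y : words) : words :=
  wlin (fun u => wlin (fun v => qsh (size u + size v) u v) y) x.

Lemma xw0 : xw [::] = 1.
Proof. by rewrite /xw; congr (<< _ >>); apply/esym/val_inj/fm1. Qed.

Lemma xwM (a b : mindex) : xw a * xw b = xw (a ++ b).
Proof.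
rewrite /xw [LHS]fgmulUU mulr1; congr (<< _ *g _ >>).
by apply/val_inj/fmM.
Qed.

Lemma wlinEw (V : lmodType 'F_p) (f : mindex -> V) (d : {fset {fmonom posnat}})
    (x : words) :
  msupp x `<=` d -> wlin f x = \sum_(w <- d) x@_w *: f (fmonom_val w).
Proof.
move=> sd; rewrite /wlin; apply: big_fset_incl => // w _ /mcoeff_outdom ->.
by rewrite scale0r.
Qed.

Lemma wlin_is_linear (V : lmodType 'F_p) (f : mindex -> V) : linear (wlin f).
Proof.
move=> c x y; pose d := msupp x `|` msupp y.
have sx : msupp x `<=` d by apply: fsubsetUl.
have sy : msupp y `<=` d by apply: fsubsetUr.
have sc : msupp (c *: x) `<=` d by apply: fsubset_trans (msuppZ_le _ _) sx.
have sxy : msupp (c *: x + y) `<=` d.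
  by apply: fsubset_trans (msuppD_le _ _) _; rewrite fsubUset sc.
rewrite (wlinEw f sx) (wlinEw f sy) (wlinEw f sxy) scaler_sumr -big_split /=.
apply: eq_bigr => w _.
by rewrite (mcoeffD w (c *: x) y) (mcoeffZ c x w) scalerDl scalerA.
Qed.

Lemma wlin_fun_linear (V : lmodType 'F_p) c (f g : mindex -> V) (x : words) :
  wlin (fun w => c *: f w + g w) x = c *: wlin f x + wlin g x.
Proof.
rewrite /wlin scaler_sumr -big_split; apply: eq_bigr => w _.
by rewrite scalerDr !scalerA mulrC.
Qed.

Lemma wlin_xw (V : lmodType 'F_p) (f : mindex -> V) (a : mindex) :
  wlin f (xw a) = f a.
Proof.
by rewrite (wlinEw f (d := [fset FMonom a]%fset)) ?msuppU1 ?fsubset_refl //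
  big_seq_fset1 mcoeffUU scale1r.
Qed.

Definition depth_le (d : nat) (x : words) : Prop :=
  forall w, w \in msupp x -> (size (fmonom_val w) <= d)%N.

Lemma depth_le0 d : depth_le d 0.
Proof. by move=> w; rewrite msupp0 in_fset0. Qed.

Lemma depth_leD d x y : depth_le d x -> depth_le d y -> depth_le d (x + y).
Proof.
move=> hx hy w /(fsubsetP (msuppD_le _ _)); rewrite in_fsetU.
by case/orP; [apply: hx | apply: hy].
Qed.

Lemma depth_leZ d c x : depth_le d x -> depth_le d (c *: x).
Proof. by move=> hx w /(fsubsetP (msuppZ_le _ _)); apply: hx. Qed.

Lemma depth_le_sum d (I : Type) (s : seq I) (P : pred I) (f : I -> words) :
  (forall i, P i -> depth_le d (f i)) -> depth_le d (\sum_(i <- s | P i) f i).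
Proof.
by move=> h; apply: big_ind => //; [apply: depth_le0 | apply: depth_leD].
Qed.

Lemma depth_leW d e x : (d <= e)%N -> depth_le d x -> depth_le e x.
Proof. by move=> le_de hx w /hx /leq_trans; apply. Qed.

Lemma depth_le_xw a d : (size a <= d)%N -> depth_le d (xw a).
Proof. by move=> ha w; rewrite msuppU1 in_fset1 => /eqP->. Qed.

Lemma depth_leM d e x y : depth_le d x -> depth_le e y -> depth_le (d + e) (x * y).
Proof.
move=> hx hy w /msuppM_le [w1 [w2 [/hx h1 /hy h2 ->]]].
by rewrite fmM size_cat leq_add.
Qed.

Lemma depth_le_wlin d e (f : mindex -> words) x : depth_le d x ->
  (forall w, (size w <= d)%N -> depth_le e (f w)) -> depth_le e (wlin f x).
Proof.
move=> hx hf; rewrite /wlin big_seq; apply: depth_le_sum => w /hx hw.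
exact/depth_leZ/hf.
Qed.

Lemma qsh_nil n v : qsh n [::] v = xw v.
Proof. by case: n. Qed.

Lemma qsh_nilr n u : qsh n u [::] = xw u.
Proof. by case: n u => [|n] [|]. Qed.

Lemma depth_le_qsh n u v : (size u + size v <= n)%N ->
  depth_le (size u + size v) (qsh n u v).
Proof.
elim: n u v => [|n IHn] [|a u] [|b v] //= le_n; try exact: depth_le_xw.
  by apply: depth_le_xw; rewrite addn0.
have l1 k : depth_le 1 (xl k) by apply: depth_le_xw.
have l2 k : depth_le 1 (xw [:: k]) by apply: depth_le_xw.
move: le_n; rewrite addSn addnS !ltnS => le_n.
have hD : depth_le (size u + size v) (qsh n u v).
  by apply: IHn; apply: leq_trans le_n.
do ![apply: depth_leD].
- by rewrite -add1n -addnS; apply: depth_leM => //; apply: IHn; rewrite /= addnS.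
- by rewrite -add1n -addSn; apply: depth_leM => //; apply: IHn; rewrite /= addSn.
- by apply: (@depth_leW (1 + (size u + size v))%N); rewrite ?leqnSn //;
    apply: depth_leM.
apply: depth_le_sum => j _; apply: depth_leZ; rewrite -add1n.
apply: depth_leM => //; apply: depth_le_wlin hD _ => w hw.
apply: (@depth_leW (size w + 1)%N); first by rewrite addn1 ltnS.
by apply: (IHn w [:: posn j]); rewrite /= addn1; apply: leq_ltn_trans hw _.
Qed.

Lemma eq_wlin (V : lmodType 'F_p) (f g : mindex -> V) d x : depth_le d x ->
  (forall w, (size w <= d)%N -> f w = g w) -> wlin f x = wlin g x.
Proof.
move=> hx hfg; rewrite /wlin !big_seq; apply: eq_bigr => w /hx hw.
by rewrite hfg.
Qed.

Lemma qshS n a b u v :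
  qsh n.+1 (a :: u) (b :: v) =
    xw [:: a] * qsh n u (b :: v) + xw [:: b] * qsh n (a :: u) v
    + xl (val a + val b) * qsh n u v
    + \sum_(1 <= j < val a + val b | (q.-1 %| j)%N)
        Delta j (val a) (val b) *:
        (xl (val a + val b - j) *
         wlin (fun w => qsh n w [:: posn j]) (qsh n u v)).
Proof. by []. Qed.

Local Opaque qsh.

Lemma qsh_bound n m u v : (size u + size v <= n)%N -> (size u + size v <= m)%N ->
  qsh n u v = qsh m u v.
Proof.
elim: n m u v => [|n IHn] m u v.
  by case: u => [|a u]; [rewrite !qsh_nil | case: v => [|b v]; rewrite ?qsh_nilr].
case: u => [|a u]; first by rewrite !qsh_nil.
case: v => [|b v]; first by rewrite !qsh_nilr.
move=> le_n le_m; have sE : (size (a :: u) + size (b :: v) = (size u + size v).+2)%N.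
  by rewrite /= addSn addnS.
rewrite {}sE !ltnS in le_n le_m.
case: m le_m => [|m] le_m; first by exfalso; move: le_m.
rewrite ltnS in le_m; have hn := ltnW le_n; have hm := ltnW le_m.
have su : (size u + size (b :: v) = (size u + size v).+1)%N by rewrite /= addnS.
have sv : (size (a :: u) + size v = (size u + size v).+1)%N by rewrite /= addSn.
have e1 : qsh n u (b :: v) = qsh m u (b :: v) by apply: IHn; rewrite su.
have e2 : qsh n (a :: u) v = qsh m (a :: u) v by apply: IHn; rewrite sv.
rewrite !qshS e1 e2 (IHn m u v hn hm).
apply: congr1; apply: eq_bigr => j _.
apply: congr1; apply: congr1.
apply: (@eq_wlin _ _ _ (size u + size v)%N); first exact: depth_le_qsh.
by move=> w hw; apply: IHn; rewrite /= addn1; apply: leq_ltn_trans hw _.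
Qed.

Lemma qshuffle_xw u v : qshuffle (xw u) (xw v) = qsh (size u + size v) u v.
Proof. by rewrite /qshuffle !wlin_xw. Qed.

Lemma qshufflePl c x y z :
  qshuffle (c *: x + y) z = c *: qshuffle x z + qshuffle y z.
Proof. exact: wlin_is_linear. Qed.

Lemma qshufflePr c x y z :
  qshuffle z (c *: x + y) = c *: qshuffle z x + qshuffle z y.
Proof.
rewrite /qshuffle -wlin_fun_linear; apply: eq_bigr => w _.
by apply: congr1; apply: wlin_is_linear.
Qed.

Lemma wlin_xwE x : wlin xw x = x.
Proof.
rewrite [RHS](monalgE x); apply: eq_bigr => w _; apply/malgP => k.
rewrite (mcoeffZ (x@_w) (xw (fmonom_val w)) k) !mcoeffU fmK.
by case: eqP => _; rewrite ?mulr1n ?mulr0n ?mulr1 ?mulr0.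
Qed.

Lemma qshuffle1x x : qshuffle 1 x = x.
Proof.
rewrite -xw0 /qshuffle wlin_xw -[RHS]wlin_xwE.
by apply: eq_bigr => w _; rewrite qsh_nil.
Qed.

Lemma qshufflex1 x : qshuffle x 1 = x.
Proof.
rewrite -xw0 /qshuffle -[RHS]wlin_xwE.
by apply: eq_bigr => w _; rewrite wlin_xw qsh_nilr.
Qed.

Lemma qshuffle_rec (a b : posnat) (u v : mindex) :
  qshuffle (xw (a :: u)) (xw (b :: v)) =
    xw [:: a] * qshuffle (xw u) (xw (b :: v))
    + xw [:: b] * qshuffle (xw (a :: u)) (xw v)
    + xl (val a + val b) * qshuffle (xw u) (xw v)
    + \sum_(1 <= j < val a + val b | (q.-1 %| j)%N)
        Delta j (val a) (val b) *:
        (xl (val a + val b - j) *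
         qshuffle (qshuffle (xw u) (xw v)) (xl j)).
Proof.
rewrite !qshuffle_xw.
have -> : (size (a :: u) + size (b :: v) = (size u + size v).+2)%N.
  by rewrite /= addSn addnS.
have -> : (size u + size (b :: v) = (size u + size v).+1)%N by rewrite /= addnS.
have -> : (size (a :: u) + size v = (size u + size v).+1)%N by rewrite /= addSn.
rewrite qshS (@qsh_bound _ _ u v (leqnSn _) (leqnn _)).
apply: congr1; apply: eq_bigr => j _; apply: congr1; apply: congr1.
apply: (@eq_wlin _ _ _ (size u + size v)%N); first exact: depth_le_qsh.
by move=> w hw; rewrite wlin_xw; apply: qsh_bound; rewrite /= addn1.
Qed.

End Words.

Definition Ehat (R : realType) (F : finFieldType) (M : Cinf_model R F)
    (r p : nat) (x : words p) (z : Omega M r) : Cinf M :=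
  \sum_(w <- msupp x) (x@_w : nat)%:R * Eis (fmonom_val w) z.

(* Main.v *)
(* The product formula already holds exactly for finite truncations.  Restrict
   the sums to vectors f in A^r all of whose coordinates have degree < N, and
   read the r coordinates as consecutive blocks of coefficients of one
   polynomial of degree < r * N, the first coordinate being the most significant
   block.  Then positive becomes monic, the order becomes comparison of degrees,
   and f |-> <f, z> becomes an F_q-linear map phi that vanishes only at 0.  For
   every such phi the power sums
   S_d(k) = sum of phi(f)^-k over the monic f of degree d satisfy
     S_d(a) S_d(b) = S_d(a + b) + sum_j Delta_j S_d(a + b - j) S_{<d}(j),
   because 1 / (f^a g^b) expands in partial fractions along f - g = c h, where
   c is a nonzero constant and h is monic of smaller degree, and the sum of
   c^-j over the nonzero c is -1 if q - 1 divides j and 0 otherwise.  The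
   q-shuffle product formula for S_{<d} follows by induction on the depth.
   It remains to let N tend to infinity.  Since the coordinates of z are
   independent over the complete field K_infty, |<f, z>| >= delta max |f_i| for
   some delta > 0, and one can take delta = q^-n on Omega_n; hence truncating
   at N causes an error O(q^-N), uniformly on Omega_n. *)

Require Import Defs.
From HB Require Import structures.
From mathcomp Require Import all_boot all_order all_algebra all_field.
From mathcomp Require Import finmap.
From mathcomp Require Import boolp classical_sets reals.
From mathcomp Require Import mpoly monalg.
From mathcomp Require Import ring zify.

Set Implicit Arguments.
Unset Strict Implicit.
Unset Printing Implicit Defensive.

Import Order.TTheory GRing.Theory Num.Theory.
Local Open Scope ring_scope.

(** * Power sums of monic polynomials *)

(** If q - 1 divides j, every term is 1 and there are q - 1 of them, which is -1 in F. Otherwise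
    some unit c has c^j different from 1; multiplication by c permutes the units, so the nonzero
    factor c^j - 1 kills the sum. *)
Lemma sum_expf_units (F : finFieldType) (j : nat) :
  \sum_(c : F | c != 0) c ^+ j = if (#|F|.-1 %| j)%N then -1 else 0.
Proof.
have card_gt1 := finNzRing_gt1 F.
have expf1 (c : F) : c != 0 -> c ^+ #|F|.-1 = 1.
  move=> c0; apply: (mulfI c0); rewrite -exprS prednK ?mulr1 ?expf_card //.
  exact: ltnW.
have nz_card : #|[pred c : F | c != 0]| = #|F|.-1.
  by have := cardC1 (0 : F); rewrite -(eq_card (A := [pred c : F | c != 0])).
case: ifPn => [/dvdnP[k ->]|ndvd].
  rewrite (eq_bigr (fun=> 1)) => [|c c0]; last by rewrite mulnC exprM expf1 ?expr1n.
  rewrite sumr_const nz_card; apply/eqP; rewrite -addr_eq0 -mulrSr prednK; last exact: ltnW.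
  (* Translation by 1 permutes F, which forces [#|F|%:R = 0] in F. *)
  have: \sum_(x : F) x = \sum_(x : F) x + #|F|%:R.
    by rewrite {1}(reindex_inj (addIr 1)) big_split /= sumr_const.
  by move/(congr1 (fun y => y - \sum_(x : F) x)); rewrite subrr addrAC subrr add0r => <-.
pose k := (j %% #|F|.-1)%N.
have q1_gt0 : (0 < #|F|.-1)%N by rewrite -ltnS prednK // ltnW.
have k_gt0 : (0 < k)%N by rewrite lt0n.
have expk (c : F) : c != 0 -> c ^+ j = c ^+ k.
  by move=> c0; rewrite {1}(divn_eq j #|F|.-1) exprD mulnC exprM expf1 // expr1n mul1r.
(* Otherwise all q - 1 units would be roots of X^k - 1, whose degree k is less than q - 1. *)
have [c /andP[c0 ck]] : exists c : F, (c != 0) && (c ^+ k != 1).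
  apply/existsP; apply: contraLR (ltn_pmod j q1_gt0); rewrite negb_exists => /forallP all1.
  rewrite -leqNgt -/k -nz_card cardE -ltnS -(size_XnsubC (1 : F) k_gt0).
  apply: max_poly_roots; rewrite ?enum_uniq ?monic_neq0 ?monicXnsubC //.
  apply/allP => c; rewrite mem_enum inE => c0.
  by have:= all1 c; rewrite c0 negbK /root !hornerE subr_eq0.
have sE : c ^+ j * \sum_(d : F | d != 0) d ^+ j = \sum_(d : F | d != 0) d ^+ j.
  rewrite [RHS](reindex_inj (mulfI c0)) /= mulr_sumr; apply: eq_big => d.
    by rewrite mulf_eq0 negb_or c0.
  by rewrite exprMn.
apply/eqP; have /eqP := sE; rewrite -[X in _ == X]mul1r -subr_eq0 -mulrBl mulf_eq0.
by rewrite subr_eq0 expk // (negPf ck).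
Qed.

(** * Partial fractions *)

Section PartialFractions.
Variable C : comNzRingType.

(* With x = 1/X, y = 1/Y and w = 1/(X + Y), this is the part involving X of the
   partial fraction expansion of 1 / (X^(n-b+1) Y^(b+1)); working with the
   inverses makes the expansion a ring identity. *)
Definition pfrac_part (n b : nat) (x w : C) : C :=
  \sum_(k < n.+1) 'C(k, b)%:R * x ^+ (n - k).+1 * w ^+ k.+1.

(** Pascal's rule on the coefficients; the term k = 0 drops out because its binomial coefficient
    vanishes. *)
Lemma pfrac_partS n b x w :
  pfrac_part n.+1 b.+1 x w = w * (pfrac_part n b.+1 x w + pfrac_part n b x w).
Proof.
rewrite /pfrac_part big_ord_recl bin0n !mul0r add0r -big_split mulr_sumr.
apply: eq_bigr => k _; rewrite !lift0 subSS binS natrD [w ^+ k.+2]exprS; rewrite /=; ring.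
Qed.

Lemma pfrac_partS0 n x w :
  pfrac_part n.+1 0 x w = w * (x ^+ n.+2 + pfrac_part n 0 x w).
Proof.
rewrite /pfrac_part big_ord_recl bin0 mul1r subn0 mulrDr expr1 mulrC; congr (_ + _).
rewrite mulr_sumr; apply: eq_bigr => k _.
by rewrite !lift0 subSS !bin0 [w ^+ k.+2]exprS; ring.
Qed.

Lemma pfrac_part_small n b x w : (n < b)%N -> pfrac_part n b x w = 0.
Proof.
move=> lt_nb; rewrite /pfrac_part big1 // => k _.
by rewrite bin_small ?mul0r // (leq_trans _ lt_nb).
Qed.

(** Induction on both exponents: one factor x * y is traded for w * (x + y), and by [pfrac_partS]
    the right side obeys the same recursion. [base] covers the case where one exponent is 1. *)
Lemma partial_fractions a b x y w : x * y = w * (x + y) ->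
  x ^+ a.+1 * y ^+ b.+1 = pfrac_part (a + b) b x w + pfrac_part (a + b) a y w.
Proof.
move=> xy.
have base c u v : u * v = w * (u + v) ->
    u * v ^+ c.+1 = pfrac_part c c u w + pfrac_part c 0 v w.
  move=> uv; elim: c => [|c IHc].
    by rewrite /pfrac_part !big_ord1 !bin0 subn0 expr1 uv; ring.
  rewrite pfrac_partS pfrac_partS0 pfrac_part_small // add0r.
  transitivity (w * (v ^+ c.+2 + u * v ^+ c.+1)); last by rewrite IHc; ring.
  by rewrite (exprS v c.+1) [LHS]mulrA uv; ring.
elim: a b => [|a IHa] b; first by rewrite add0n expr1 base.
elim: b => [|b IHb].
  rewrite addn0 mulrC expr1 base; first by rewrite addrC.
  by rewrite mulrC xy addrC.
rewrite addSn addnS !(pfrac_partS (a + b).+1).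
transitivity (w * (x ^+ a.+1 * y ^+ b.+2 + x ^+ a.+2 * y ^+ b.+1)).
  have -> : x ^+ a.+2 * y ^+ b.+2 = x ^+ a.+1 * y ^+ b.+1 * (x * y).
    by rewrite !exprS; ring.
  by rewrite xy !exprS; ring.
by rewrite IHa IHb addSn addnS; ring.
Qed.

End PartialFractions.

Lemma size_rVpoly (R : nzSemiRingType) (d : nat) (u : 'rV[R]_d) : (size (rVpoly u) <= d)%N.
Proof. exact: size_poly. Qed.

(** * Products of power sums *)

Section PowerSums.
Variables (F : finFieldType) (C : fieldType) (iota : {rmorphism F -> C}).
Variables (phi : {poly F} -> C) (m : nat).
Hypothesis phiP : forall (c : F) (f g : {poly F}), phi (c *: f + g) = iota c * phi f + phi g.
Hypothesis phi_neq0 : forall f : {poly F}, f != 0 -> (size f <= m)%N -> phi f != 0.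

(** The polynomials ['X^d + rVpoly u] are exactly the monic ones of degree d, so this is S_d(k) for
    [phi]. *)
Definition monic_powsum (d k : nat) : C :=
  \sum_(u : 'rV[F]_d) (phi ('X^d + rVpoly u) ^+ k)^-1.

Lemma semilin0 : phi 0 = 0.
Proof.
have := phiP 1 0 0; rewrite scale1r addr0 rmorph1 mul1r => /eqP.
by rewrite -subr_eq subrr eq_sym => /eqP.
Qed.

Lemma semilinZ c f : phi (c *: f) = iota c * phi f.
Proof. by rewrite -[c *: f]addr0 phiP semilin0 addr0. Qed.

Lemma semilinB f g : phi (f - g) = phi f - phi g.
Proof. by rewrite addrC -scaleN1r phiP rmorphN1 mulN1r addrC. Qed.

(** Each nonzero polynomial of degree < d is uniquely a unit c times a monic polynomial of degree e
    < d, and the sum over c factors out. The induction on d splits on whether the top coefficient is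
    zero. *)
Lemma sum_phi_nz (d j : nat) :
  \sum_(u : 'rV[F]_d | u != 0) (phi (rVpoly u) ^+ j)^-1 =
  (if (#|F|.-1 %| j)%N then -1 else 0) * \sum_(e < d) monic_powsum e j.
Proof.
(* The substitution of c^-1 for c reduces negative powers to [sum_expf_units]. *)
have sum_units : \sum_(c : F | c != 0) (iota c ^+ j)^-1 =
    (if (#|F|.-1 %| j)%N then -1 else 0) :> C.
  transitivity (iota (if (#|F|.-1 %| j)%N then -1 else 0)); last first.
    by case: ifP => _; rewrite ?rmorphN1 ?rmorph0.
  rewrite -sum_expf_units (reindex_inj invr_inj) rmorph_sum.
  by apply: eq_big => c; rewrite ?invr_eq0 // => _; rewrite fmorphV exprVn invrK rmorphXn.
elim: d => [|d IHd].
  by rewrite big_ord0 mulr0 big_pred0 // => u; rewrite thinmx0 eqxx.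
pose h (cu : F * 'rV[F]_d) : 'rV[F]_d.+1 := poly_rV (cu.1 *: 'X^d + rVpoly cu.2).
have szh c (u : 'rV[F]_d) : (size (c *: 'X^d + rVpoly u : {poly F})%R <= d.+1)%N.
  apply: leq_trans (size_polyD _ _) _; rewrite geq_max; apply/andP; split.
    by apply: leq_trans (size_scale_leq _ _) _; rewrite size_polyXn.
  exact: leq_trans (size_rVpoly _) (leqnSn _).
have hE c (u : 'rV[F]_d) : rVpoly (h (c, u)) = c *: 'X^d + rVpoly u by rewrite poly_rV_K.
have h_bij : bijective h.
  exists (fun v : 'rV[F]_d.+1 => ((rVpoly v)`_d, poly_rV (rVpoly v))) => [[c u]|v].
    rewrite hE coefD coefZ coefXn eqxx mulr1 nth_default ?size_rVpoly // addr0.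
    congr pair; apply/rowP => i.
    by rewrite mxE coefD coefZ coefXn coef_rVpoly_ord ltn_eqF // mulr0 add0r.
  apply: (can_inj rVpolyK); rewrite hE; apply/polyP => i.
  rewrite coefD coefZ coefXn; case: (ltngtP i d) => [lt_id|gt_id|->].
  - by rewrite mulr0 add0r (coef_rVpoly_ord _ (Ordinal lt_id)) mxE.
  - by rewrite mulr0 add0r !nth_default // (leq_trans (size_rVpoly _)) // ltnW.
  by rewrite mulr1 [X in _ + X]nth_default ?size_rVpoly // addr0.
rewrite (reindex h) /=; last exact: onW_bij.
rewrite (eq_bigl (fun cu => (cu.1 != 0) || (cu.2 != 0))) => [|[c u]]; last first.
  rewrite -(inj_eq (can_inj rVpolyK)) linear0 hE /=; have [-> | c0] /= := eqVneq c 0.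
    by rewrite scale0r add0r -(inj_eq (can_inj rVpolyK)) linear0.
  apply/eqP => /(congr1 (fun f : {poly F} => f`_d)).
  rewrite coefD coefZ coefXn eqxx mulr1 nth_default ?size_rVpoly // addr0 coef0.
  exact/eqP.
rewrite (bigID (fun cu => cu.1 == 0)) /= big_ord_recr /= mulrDr -IHd; congr (_ + _).
  rewrite (eq_bigl (fun cu => (cu.1 == 0) && (cu.2 != 0))) => [|[c u] /=]; last first.
    by have [] := eqVneq c 0; rewrite ?andbF ?andbT.
  rewrite -(pair_big (fun c => c == 0) (fun u => u != 0)
     (fun c u => (phi (rVpoly (h (c, u))) ^+ j)^-1)) big_pred1_eq.
  by apply: eq_bigr => u _; rewrite hE scale0r add0r.
rewrite (eq_bigl (fun cu => (cu.1 != 0) && true)) => [|[c u] /=]; last first.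
  by rewrite andbC andbT; case: eqP.
rewrite -(pair_big (fun c => c != 0) xpredT
   (fun c u => (phi (rVpoly (h (c, u))) ^+ j)^-1)) -sum_units mulr_suml.
apply: eq_bigr => c c0; rewrite /monic_powsum mulr_sumr.
(* Replacing u by c *: u makes c a common factor of the whole polynomial. *)
rewrite (reindex_inj (scalerI c0)); apply: eq_bigr => u _.
by rewrite hE linearZ -scalerDr semilinZ exprMn invfM.
Qed.

(* [Slt d a] is S_{<d}(a), the sum over chains of monic polynomials of strictly
   decreasing degrees < d. *)
Fixpoint Slt (d : nat) (a : mindex) : C :=
  if a is k :: a' then \sum_(e < d) monic_powsum e (val k) * Slt e a' else 1.

(** The diagonal of the double sum gives S_d(a + b). Off the diagonal, partial fractions pair the
    difference of the two polynomials with only one of them, so the sum over the other is a sum over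
    all nonzero differences, given by [sum_phi_nz]. *)
Lemma monic_powsumM (d a b : nat) : (d < m)%N -> (0 < a)%N -> (0 < b)%N ->
  monic_powsum d a * monic_powsum d b = monic_powsum d (a + b) +
  \sum_(1 <= j < a + b | (#|F|.-1 %| j)%N)
     ((-1) ^+ a.-1 * 'C(j.-1, a.-1)%:R + (-1) ^+ b.-1 * 'C(j.-1, b.-1)%:R) *
     (monic_powsum d (a + b - j) * \sum_(e < d) monic_powsum e j).
Proof.
case: a b => [|a] [|b] // lt_dm _ _.
pose X (u : 'rV[F]_d) := phi ('X^d + rVpoly u).
have X0 u : X u != 0.
  have su : (size (rVpoly u) < size ('X^d : {poly F}))%N.
    by rewrite size_polyXn ltnS size_rVpoly.
  apply: phi_neq0; last by rewrite size_polyDl // size_polyXn.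
  by rewrite -size_poly_eq0 size_polyDl // size_polyXn.
have XB u v : X u - X v = phi (rVpoly (u - v)).
  by rewrite -semilinB linearB /= opprD addrACA subrr add0r.
(* Partial fractions for 1 / X u and -1 / X v, whose third quantity is 1 / (X u - X v). *)
have pf u v : u != v -> (X u ^+ a.+1)^-1 * (X v ^+ b.+1)^-1 =
    \sum_(k < (a + b).+1)
      ((-1) ^+ b.+1 * 'C(k, b)%:R * (X u ^+ (a + b - k).+1)^-1 * (phi (rVpoly (u - v)) ^+ k.+1)^-1 +
       (-1) ^+ a.+1 * 'C(k, a)%:R * (X v ^+ (a + b - k).+1)^-1 * (phi (rVpoly (v - u)) ^+ k.+1)^-1).
  move=> uv; pose w := X u - X v.
  have w0 : w != 0.
    rewrite /w XB phi_neq0 ?(leq_trans (size_rVpoly _)) 1?ltnW //.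
    by rewrite -(linear0 (@rVpoly F d)) (inj_eq (can_inj rVpolyK)) subr_eq0.
  have inv_xy : (X u)^-1 * (- X v)^-1 = w^-1 * ((X u)^-1 + (- X v)^-1).
    by rewrite /w in w0 *; field; rewrite oppr_eq0 !X0 w0.
  have wE : phi (rVpoly (u - v)) = w by rewrite -XB.
  have wN : phi (rVpoly (v - u)) = - w by rewrite -XB opprB.
  transitivity ((-1) ^+ b.+1 * ((X u)^-1 ^+ a.+1 * (- X v)^-1 ^+ b.+1)).
    rewrite invrN [(- _^-1) ^+ _]exprNn !exprVn mulrCA [X in _ = _ * X]mulrA.
    by rewrite -expr2 sqrr_sign mul1r.
  rewrite (partial_fractions _ _ inv_xy) -big_split mulr_sumr; apply: eq_bigr => k _ /=.
  rewrite wE wN -!exprVn !invrN ![(- _^-1) ^+ _]exprNn mulrDr; congr (_ + _).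
    by rewrite !mulrA.
  (* Both exponents have the parity of a + k. *)
  have sgn : (-1) ^+ b.+1 * (-1) ^+ (a + b - k).+1 = (-1) ^+ a.+1 * (-1) ^+ k.+1 :> C.
    rewrite -!exprD -[LHS]signr_odd -[RHS]signr_odd; congr (_ ^+ _).
    have /(congr1 odd) : (a + b - k + k = a + b)%N by rewrite subnK // -ltnS.
    by rewrite !oddD /=; do 4![case: (odd _)].
  transitivity ((-1) ^+ b.+1 * (-1) ^+ (a + b - k).+1 *
    ('C(k, a)%:R * (X v)^-1 ^+ (a + b - k).+1 * w^-1 ^+ k.+1)); first by ring.
  by rewrite sgn; ring.
pose U k := \sum_(h : 'rV[F]_d | h != 0) (phi (rVpoly h) ^+ k)^-1.
(* For fixed u, the differences u - v run over all nonzero vectors, so the sum is independent of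
   u. *)
have sum_diff (u : 'rV[F]_d) k : \sum_(v | v != u) (phi (rVpoly (u - v)) ^+ k)^-1 = U k.
  rewrite /U (reindex_inj (subrI u)); apply: eq_big => v; last by rewrite subKr.
  by rewrite -subr_eq0 addrAC subrr add0r oppr_eq0.
rewrite /monic_powsum -/X big_distrlr /=.
under eq_bigr => u _ do rewrite (bigD1 u) //= -invfM -exprD.
rewrite big_split /=; congr (_ + _).
under eq_bigr => u _.
  under eq_bigr => v uv do rewrite pf 1?eq_sym //.
  rewrite exchange_big; over.
(* The summation index on the right is j = k + 1. *)
rewrite exchange_big [RHS]big_mkcond big_add1 big_mkord addSn addnS /=.
apply: eq_bigr => k _; rewrite !subSS subSn -1?ltnS //.
transitivity (((-1) ^+ b.+1 * 'C(k, b)%:R + (-1) ^+ a.+1 * 'C(k, a)%:R) *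
   ((\sum_u (X u ^+ (a + b - k).+1)^-1) * U k.+1)).
  rewrite mulrDl; under eq_bigr => u _ do rewrite big_split.
  rewrite big_split; congr (_ + _).
    rewrite mulr_suml mulr_sumr; apply: eq_bigr => u _.
    by rewrite -mulr_sumr sum_diff !mulrA.
  rewrite (exchange_big_dep predT) //= mulr_suml mulr_sumr; apply: eq_bigr => v _.
  rewrite -mulr_sumr -(sum_diff v) !mulrA; congr (_ * _).
  by apply: eq_bigl => u; rewrite eq_sym.
(* The -1 coming from the sum over units turns the signs (-1)^(b+1) and (-1)^(a+1) into those of
   [Delta]. *)
rewrite /U sum_phi_nz; case: ifP => _; last by rewrite mul0r !mulr0.
rewrite !exprS; ring.
Qed.

End PowerSums.

(** * The q-shuffle product for truncated sums *)

Lemma linear_wlin (p : nat) (V W : lmodType 'F_p) (g : V -> W) (f : mindex -> V)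
  (x : words p) : linear g -> g (wlin f x) = wlin (g \o f) x.
Proof.
move=> gP.
have g0 : g 0 = 0.
  by have := gP (-1) 0 0; rewrite scaleN1r oppr0 addr0 scaleN1r addrC subrr.
rewrite /wlin (big_morph g (id1 := 0) (op1 := +%R)) // => [|y z].
  by apply: eq_bigr => w _; rewrite -[_ *: _]addr0 gP g0 addr0.
by rewrite -[y in LHS]scale1r gP scale1r.
Qed.

Lemma linear_xwE (p : nat) (W : lmodType 'F_p) (g : words p -> W) (x : words p) :
  linear g -> g x = wlin (g \o @xw p) x.
Proof. by move=> gP; rewrite -linear_wlin // wlin_xwE. Qed.

(** The pairs of indices are sorted into first larger, second larger, and equal; this is the source
    of the recursion for the q-shuffle product. *)
Lemma big_ord_prodE (C : comNzRingType) (A B : nat -> C) (d : nat) :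
  (\sum_(e < d) A e) * (\sum_(e < d) B e) =
  \sum_(e < d) (A e * (\sum_(f < e) B f) + B e * (\sum_(f < e) A f) + A e * B e).
Proof.
elim: d => [|d IHd]; first by rewrite !big_ord0 mulr0.
by rewrite ![in LHS]big_ord_recr big_ord_recr /= -IHd; ring.
Qed.

Lemma val_posn (k : nat) : (0 < k)%N -> val (posn k) = k.
Proof. by move=> k0; rewrite /posn insubdK. Qed.

Section QShuffle.
Variables (F : finFieldType) (C : fieldType) (iota : {rmorphism F -> C}).
Variables (phi : {poly F} -> C) (m : nat).
Hypothesis phiP : forall (c : F) (f g : {poly F}), phi (c *: f + g) = iota c * phi f + phi g.
Hypothesis phi_neq0 : forall f : {poly F}, f != 0 -> (size f <= m)%N -> phi f != 0.
Variables (p : nat) (pC : p \in [pchar C]).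

Local Notation Cp := (pPrimeCharType pC).
Local Notation Slt := (Slt phi).
Local Notation Sd := (monic_powsum phi).

(** The values lie in [Cp], the field C with the F_p-algebra structure given by its characteristic,
    so that [wlin] applies. *)
Definition Slt_words (d : nat) (x : words p) : Cp := wlin (Slt d : mindex -> Cp) x.

Lemma Slt_wordsP d : linear (Slt_words d). Proof. exact: wlin_is_linear. Qed.

Lemma Slt_words_xw d a : Slt_words d (xw p a) = Slt d a. Proof. exact: wlin_xw. Qed.

Lemma Slt_words0 d : Slt_words d 0 = 0.
Proof. by rewrite /Slt_words /wlin msupp0 big_nil. Qed.

Lemma Slt_wordsZ d c x : Slt_words d (c *: x) = c *: Slt_words d x.
Proof. by have := Slt_wordsP d c x 0; rewrite Slt_words0 !addr0. Qed.

Lemma Slt_wordsD d x y : Slt_words d (x + y) = Slt_words d x + Slt_words d y.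
Proof. by have := Slt_wordsP d 1 x y; rewrite !scale1r. Qed.

(** Both sides are linear in y, and on a word this is the recursion that defines [Slt]. *)
Lemma Slt_words_consM d k (y : words p) :
  Slt_words d (xw p [:: k] * y) = \sum_(e < d) (Sd e (val k) : Cp) * Slt_words e y.
Proof.
pose g1 y := Slt_words d (xw p [:: k] * y).
pose g2 y : Cp := \sum_(e < d) (Sd e (val k) : Cp) * Slt_words e y.
have g1P : linear g1.
  by move=> c x z; rewrite /g1 mulrDr -(natr_Zp c) !scaler_nat mulrnAr -!scaler_nat Slt_wordsP.
have g2P : linear g2.
  move=> c x z; rewrite /g2 scaler_sumr -big_split; apply: eq_bigr => e _ /=.
  by rewrite Slt_wordsP mulrDr scalerAr.
rewrite -/(g1 y) -/(g2 y) (linear_xwE _ g1P) (linear_xwE _ g2P).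
apply: eq_bigr => w _; congr (_ *: _); rewrite /= /g1 /g2 xwM Slt_words_xw /=.
by apply: eq_bigr => e _; rewrite Slt_words_xw.
Qed.

Lemma scale_Delta (j a b : nat) (x : Cp) : Delta p j a b *: x =
  ((-1) ^+ a.-1 * 'C(j.-1, a.-1)%:R + (-1) ^+ b.-1 * 'C(j.-1, b.-1)%:R) * x.
Proof.
rewrite -mulr_algl -in_algE /Delta rmorphD !rmorphM !rmorphXn !rmorphN1 !rmorph_nat //.
Qed.

(** Induction on the total depth, for all d at once. In the product of the two outer sums, unequal
    leading degrees give the first two terms of the q-shuffle recursion; for equal degrees e,
    [monic_powsumM] expands S_e(a) S_e(b) into the remaining ones. *)
Lemma Slt_words_qshuffle_xw d u v : (d <= m)%N ->
  Slt_words d (qshuffle #|F| (xw p u) (xw p v)) = (Slt d u : Cp) * Slt d v.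
Proof.
have [n] := ubnP (size u + size v)%N.
elim: n u v d => // n IHn u v d.
case: u => [|a u].
  by rewrite xw0 qshuffle1x Slt_words_xw mul1r.
case: v => [|b v].
  by rewrite xw0 qshufflex1 Slt_words_xw mulr1.
rewrite /= addSn addnS !ltnS => le_n le_dm.
set Y := qshuffle #|F| (xw p u) (xw p v).
have lt_m (e : 'I_d) : (e < m)%N by apply: leq_trans le_dm.
have SY e : (e <= m)%N -> Slt_words e Y = (Slt e u : Cp) * Slt e v.
  by move=> le_em; apply: IHn => //; apply: ltnW.
(* The words of Y have depth at most |u| + |v|, so multiplying by one letter stays below the total
   depth |u| + |v| + 2 and the induction hypothesis applies to each of them. *)
have SY_l e j : (e <= m)%N ->
    Slt_words e (qshuffle #|F| Y (xl p j)) = Slt_words e Y * Slt e [:: posn j].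
  move=> le_em; pose g y := Slt_words e (qshuffle #|F| y (xl p j)).
  have gP : linear g by move=> c x1 x2; rewrite /g qshufflePl Slt_wordsP.
  transitivity (wlin (g \o @xw p) Y); first exact: linear_xwE gP.
  have Y_le : depth_le (size u + size v) Y by rewrite /Y qshuffle_xw; apply: depth_le_qsh.
  transitivity (wlin (fun w => (Slt e w : Cp) * Slt e [:: posn j]) Y).
    apply: (eq_wlin Y_le) => w w_le; apply: IHn => //.
    by rewrite /= addn1; apply: leq_ltn_trans le_n.
  by rewrite /Slt_words /wlin mulr_suml; apply: eq_bigr => w _; rewrite scalerAl.
pose S1 : Cp := \sum_(e < d) (Sd e (val a) : Cp) * (Slt e u * Slt e (b :: v)).
have E1 : Slt_words d (xw p [:: a] * qshuffle #|F| (xw p u) (xw p (b :: v))) = S1.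
  rewrite Slt_words_consM; apply: eq_bigr => e _; rewrite IHn ?(ltnW (lt_m e)) //.
  by rewrite /= addnS.
pose S2 : Cp := \sum_(e < d) (Sd e (val b) : Cp) * (Slt e (a :: u) * Slt e v).
have E2 : Slt_words d (xw p [:: b] * qshuffle #|F| (xw p (a :: u)) (xw p v)) = S2.
  rewrite Slt_words_consM; apply: eq_bigr => e _; rewrite IHn ?(ltnW (lt_m e)) //.
pose S3 : Cp := \sum_(e < d) (Sd e (val a + val b)%N : Cp) * (Slt e u * Slt e v).
have E3 : Slt_words d (xl p (val a + val b) * Y) = S3.
  rewrite Slt_words_consM; apply: eq_bigr => e _; rewrite SY ?(ltnW (lt_m e)) //.
  by rewrite val_posn // addn_gt0 (valP a).
have E4 j : (1 <= j < val a + val b)%N ->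
    Slt_words d (xl p (val a + val b - j) * qshuffle #|F| Y (xl p j)) =
    \sum_(e < d) (Sd e (val a + val b - j)%N : Cp) * (Slt e u * Slt e v * \sum_(f < e) Sd f j).
  move=> /andP[j0 ltj]; rewrite Slt_words_consM; apply: eq_bigr => e _.
  rewrite SY_l ?(ltnW (lt_m e)) // SY ?(ltnW (lt_m e)) //.
  rewrite val_posn ?subn_gt0 //= val_posn //; congr (_ * (_ * _)).
  by apply: eq_bigr => f _; rewrite mulr1.
pose S4 : Cp := \sum_(e < d) (\sum_(1 <= j < val a + val b | (#|F|.-1 %| j)%N)
     ((-1) ^+ (val a).-1 * 'C(j.-1, (val a).-1)%:R + (-1) ^+ (val b).-1 * 'C(j.-1, (val b).-1)%:R) *
     ((Sd e (val a + val b - j) : Cp) * \sum_(f < e) Sd f j)) * (Slt e u * Slt e v).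
have E5 : Slt_words d (\sum_(1 <= j < val a + val b | (#|F|.-1 %| j)%N) Delta p j (val a) (val b) *:
        (xl p (val a + val b - j) * qshuffle #|F| Y (xl p j))) = S4.
  rewrite (big_morph (Slt_words d) (Slt_wordsD d) (Slt_words0 d)).
  transitivity (\sum_(1 <= j < val a + val b | (#|F|.-1 %| j)%N) \sum_(e < d)
     ((-1) ^+ (val a).-1 * 'C(j.-1, (val a).-1)%:R + (-1) ^+ (val b).-1 * 'C(j.-1, (val b).-1)%:R) *
     ((Sd e (val a + val b - j) : Cp) * \sum_(f < e) Sd f j) * (Slt e u * Slt e v)).
    rewrite big_nat_cond [RHS]big_nat_cond; apply: eq_bigr => j /andP[j_bnd _].
    rewrite Slt_wordsZ scale_Delta E4 // mulr_sumr; apply: eq_bigr => e _.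
    by rewrite -!mulrA; congr (_ * (_ * _)); rewrite [RHS]mulrC -mulrA.
  by rewrite exchange_big; apply: eq_bigr => e _; rewrite mulr_suml.
transitivity (S1 + S2 + S3 + S4).
  rewrite qshuffle_rec 3!Slt_wordsD; congr (_ + _); last exact: E5.
  by congr (_ + _); [congr (_ + _); [exact: E1 | exact: E2] | exact: E3].
rewrite /S1 /S2 /S3 /S4 -3!big_split /=.
rewrite (big_ord_prodE (fun e => Sd e (val a) * Slt e u) (fun e => Sd e (val b) * Slt e v)).
apply: eq_bigr => e _.
rewrite -/(Slt e (a :: u)) -/(Slt e (b :: v)).
transitivity (Sd e (val a) * (Slt e u * Slt e (b :: v)) +
  Sd e (val b) * (Slt e (a :: u) * Slt e v) +
  Sd e (val a) * Sd e (val b) * (Slt e u * Slt e v)); last by rewrite /=; ring.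
rewrite (monic_powsumM phiP phi_neq0 (lt_m e) (valP a) (valP b)) mulrDl addrA.
by [].
Qed.

(** By bilinearity, first in x and then in y, it suffices to treat words. *)
Lemma Slt_words_qshuffle d x y : (d <= m)%N ->
  Slt_words d (qshuffle #|F| x y) = Slt_words d x * Slt_words d y.
Proof.
move=> le_dm.
pose g1 y x := Slt_words d (qshuffle #|F| x y); pose g2 x y := Slt_words d (qshuffle #|F| x y).
have g1P z : linear (g1 z) by move=> c x1 x2; rewrite /g1 qshufflePl Slt_wordsP.
have g2P z : linear (g2 z) by move=> c x1 x2; rewrite /g2 qshufflePr Slt_wordsP.
transitivity (wlin (g1 y \o @xw p) x); first exact: linear_xwE (g1P y).
rewrite [Slt_words d x]/Slt_words [in LHS]/wlin [in RHS]/wlin mulr_suml; apply: eq_bigr => w _.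
apply: etrans (scalerAl _ _ _); congr (_ *: _).
transitivity (wlin (g2 (xw p (fmonom_val w)) \o @xw p) y).
  exact: linear_xwE (g2P (xw p (fmonom_val w))).
rewrite [Slt_words d y]/Slt_words [in LHS]/wlin [in RHS]/wlin mulr_sumr; apply: eq_bigr => w' _.
apply: etrans (scalerAr _ _ _); congr (_ *: _); exact: Slt_words_qshuffle_xw.
Qed.

End QShuffle.

(** * Vectors of polynomials as blocks of one polynomial *)

Section Blocks.
Variables (F : finFieldType) (r N : nat).
Local Notation A := {poly F}.

(** [rev_ord] puts the first coordinate in the top block, so that the leading term of p lands in the
    first nonzero coordinate. *)
Definition split_blocks (p : A) : 'rV[A]_r :=
  \row_i take_poly N (drop_poly (N * rev_ord i) p).

Definition join_blocks (f : 'rV[A]_r) : A := \sum_(i < r) f 0 i * 'X^(N * rev_ord i).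

Definition in_box (f : 'rV[A]_r) : bool := [forall i, (size (f 0%R i) <= N)%N].

Lemma split_blocksP (c : F) (f g : A) :
  split_blocks (c *: f + g) = c%:P *: split_blocks f + split_blocks g.
Proof.
apply/rowP => i; rewrite !mxE drop_polyD drop_polyZ take_polyD take_polyZ.
by rewrite mul_polyC.
Qed.

Lemma ltn_rev_ord (i j : 'I_r) : (rev_ord i < rev_ord j)%N = (j < i)%N.
Proof. by rewrite /=; have := ltn_ord i; have := ltn_ord j; lia. Qed.

Lemma join_blocksK f : in_box f -> split_blocks (join_blocks f) = f.
Proof.
move=> /forallP szf; apply/rowP => i; rewrite mxE; apply/polyP => t.
rewrite coef_take_poly; case: ltnP => [lt_tN|le_Nt]; last first.
  by rewrite nth_default // (leq_trans (szf i)).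
rewrite coef_drop_poly coef_sum (bigD1 i) //= big1 => [|j ji].
  by rewrite addr0 coefMXn addnC ltnNge leq_addr /= addKn.
rewrite coefMXn; case: ltnP => // le_j.
rewrite nth_default // (leq_trans (szf j)) //.
(* A block above that of i starts beyond the coefficient in question, and a block below it ends
   before. *)
have [lt_ij|lt_ji|/ord_inj/rev_ord_inj eq_ij] := ltngtP (rev_ord i) (rev_ord j).
- by have := leq_mul (leqnn N) lt_ij; rewrite /= mulnS; lia.
- by have := leq_mul (leqnn N) lt_ji; rewrite /= mulnS; lia.
by rewrite eq_ij eqxx in ji.
Qed.

Lemma size_join_blocks f : in_box f -> (size (join_blocks f) <= r * N)%N.
Proof.
move=> /forallP szf; apply: (leq_trans (size_sum _ _ _)); apply/bigmax_leqP => i _.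
have [->|fi0] := eqVneq (f 0 i) 0; first by rewrite mul0r size_poly0.
rewrite size_Mmonic ?monicXn // size_polyXn addnS /=.
have := leq_mul (leqnn N) (ltn_ord (rev_ord i)); rewrite mulnS [(r * N)%N]mulnC /=.
by move=> le_r; apply: leq_trans le_r; rewrite leq_add2r szf.
Qed.

Lemma in_box_split p : in_box (split_blocks p).
Proof. by apply/forallP => i; rewrite mxE size_take_poly. Qed.

(** Euclidean division of deg p by N: the quotient locates the block of the leading term, and the
    remainder is the degree of that block. *)
Lemma split_blocks_lead (p : A) : p != 0 -> (size p <= r * N)%N -> exists i : 'I_r,
  [/\ forall j : 'I_r, (j < i)%N -> split_blocks p 0 j = 0,
      split_blocks p 0 i != 0,
      lead_coef (split_blocks p 0 i) = lead_coef p &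
      size p = (N * rev_ord i + size (split_blocks p 0%R i))%N].
Proof.
move=> p0 szp; have szp0 : (0 < size p)%N by rewrite size_poly_gt0.
have N0 : (0 < N)%N by case: N szp => //; rewrite muln0; lia.
have lt_k : ((size p).-1 %/ N < r)%N by rewrite ltn_divLR //; lia.
have [i iE] : exists i : 'I_r, rev_ord i = ((size p).-1 %/ N)%N :> nat.
  by exists (rev_ord (Ordinal lt_k)); rewrite rev_ordK.
exists i.
have [l lt_l szE] : exists2 l, (l < N)%N & size p = (N * rev_ord i + l.+1)%N.
  exists ((size p).-1 %% N)%N; first exact: ltn_pmod.
  by rewrite iE addnS [(N * _)%N]mulnC -divn_eq prednK.
have blockE : split_blocks p 0 i = drop_poly (N * rev_ord i) p.
  by rewrite mxE take_poly_id // size_drop_poly szE addKn.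
have sz_drop : size (drop_poly (N * rev_ord i) p) = l.+1.
  by rewrite size_drop_poly szE addKn.
split.
- move=> j; rewrite -ltn_rev_ord mxE => lt_ij; rewrite drop_poly_eq0 ?take_poly0r //.
  have := leq_mul (leqnn N) lt_ij; rewrite mulnS szE => le_N.
  by apply: leq_trans le_N; rewrite addnC leq_add2r.
- by rewrite blockE -size_poly_gt0 sz_drop.
- by rewrite blockE !lead_coefE sz_drop /= coef_drop_poly szE addnS /= addnC.
by rewrite blockE sz_drop.
Qed.

Lemma split_blocks_neq0 (p : A) : p != 0 -> (size p <= r * N)%N -> split_blocks p != 0.
Proof.
move=> p0 szp; have [i [_ i0 _ _]] := split_blocks_lead p0 szp.
by apply: contraNneq i0 => ->; rewrite mxE.
Qed.

(** Splitting is linear and, in the allowed range of sizes, has trivial kernel. *)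
Lemma split_blocks_inj (p g : A) : (size p <= r * N)%N -> (size g <= r * N)%N ->
  split_blocks p = split_blocks g -> p = g.
Proof.
move=> szp szg /eqP; apply: contraTeq => pg.
have: split_blocks (-1 *: g + p) != 0.
  rewrite split_blocks_neq0 ?scaleN1r // addrC ?subr_eq0 //.
  by apply: leq_trans (size_polyD _ _) _; rewrite size_polyN geq_max szp szg.
rewrite split_blocksP; apply: contraNneq => ->.
by rewrite polyCN scaleN1r addNr.
Qed.

Lemma succ0_split (p : A) : (size p <= r * N)%N -> succ0 (split_blocks p) = (p \is monic).
Proof.
have [->|p0] := eqVneq p 0.
  move=> _; rewrite monicE lead_coef0 eq_sym oner_eq0; apply/existsP => -[i /andP[_]].
  by rewrite mxE drop_poly0r take_poly0r monicE lead_coef0 eq_sym oner_eq0.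
move=> szp; have [i [i_lt i0 lead_i _]] := split_blocks_lead p0 szp.
apply/existsP/idP => [[j /andP[/forallP j_lt j_mon]]|p_mon]; last first.
  exists i; rewrite monicE lead_i -monicE p_mon andbT.
  by apply/forallP => j; apply/implyP => /i_lt ->.
have -> : p \is monic = (split_blocks p 0 i \is monic) by rewrite !monicE lead_i.
have [lt_ij|lt_ji|/val_inj -> //] := ltngtP i j.
  by have := j_lt i; rewrite lt_ij (negPf i0).
by move: j_mon; rewrite i_lt // monicE lead_coef0 eq_sym oner_eq0.
Qed.

(** Let i and j be the first nonzero coordinates of the two vectors. Nonzero blocks have sizes from
    1 to N, so comparing total sizes means comparing the positions i and j first and the block
    degrees second, which is the order [succ]. *)
Lemma succ_split (p g : A) : (size p <= r * N)%N -> (size g <= r * N)%N ->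
  p \is monic -> g \is monic ->
  succ (split_blocks p) (split_blocks g) = (size g < size p)%N.
Proof.
move=> szp szg pm gm; rewrite /succ !succ0_split // pm gm /=.
have [i [i_lt i0 lead_i sz_i]] := split_blocks_lead (monic_neq0 pm) szp.
have [j [j_lt j0 lead_j sz_j]] := split_blocks_lead (monic_neq0 gm) szg.
have i_mon : split_blocks p 0 i \is monic by rewrite monicE lead_i -monicE.
have j_mon : split_blocks g 0 j \is monic by rewrite monicE lead_j -monicE.
have /forallP szpi := in_box_split p; have /forallP szgi := in_box_split g.
have spi : (0 < size (split_blocks p 0%R i))%N by rewrite size_poly_gt0.
have sgj : (0 < size (split_blocks g 0%R j))%N by rewrite size_poly_gt0.
have := szpi i; have := szgi j => lej lei.
apply/existsP/idP => [[k /andP[/forallP k_lt]]|lt_gp].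
  have k_ltP (l : 'I_r) : (l < k)%N -> (split_blocks p 0 l == 0) && (split_blocks g 0 l == 0).
    exact/implyP.
  have kp : split_blocks p 0 k \is monic -> k = i.
    move=> k_mon; have [lt_ki|lt_ik|/val_inj -> //] := ltngtP k i.
      by move: k_mon; rewrite i_lt // monicE lead_coef0 eq_sym oner_eq0.
    by have /andP[] := k_ltP i lt_ik; rewrite (negPf i0).
  case/orP => [/and3P[/kp ki g_mon lt_sz]|/andP[/kp ki g0]].
    have kj : k = j.
      have [lt_kj|lt_jk|/val_inj -> //] := ltngtP k j.
        by move: g_mon; rewrite j_lt // monicE lead_coef0 eq_sym oner_eq0.
      by have /andP[_] := k_ltP j lt_jk; rewrite (negPf j0).
    by rewrite sz_i sz_j -ki -kj ltn_add2l.
  have lt_ij : (i < j)%N.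
    rewrite ltn_neqAle leqNgt; apply/andP; split.
      by apply: contraNneq j0 => /val_inj <-; rewrite -ki.
    by apply/negP; rewrite -ki => lt_jk; have /andP[_] := k_ltP j lt_jk; rewrite (negPf j0).
  by move: lt_ij; rewrite -ltn_rev_ord sz_i sz_j; nia.
have [lt_ij|lt_ji|/val_inj eq_ij] := ltngtP i j.
- exists i; rewrite i_mon j_lt // eqxx orbT andbT; apply/forallP => k.
  by apply/implyP => lt_ki; rewrite i_lt // j_lt ?eqxx //; apply: ltn_trans lt_ij.
- by move: lt_ji lt_gp; rewrite -ltn_rev_ord sz_i sz_j; nia.
subst j; exists i; rewrite i_mon j_mon /= -(ltn_add2l (N * rev_ord i)) -sz_i -sz_j lt_gp andbT.
by apply/forallP => k; apply/implyP => lt_ki; rewrite i_lt // j_lt ?eqxx.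
Qed.

(** After f of degree e, the tail gets the bound [(size f).-1] = e, hence degrees < e; the recursion
    mirrors that of [Slt]. *)
Fixpoint monic_chains (m d : nat) : seq (seq A) :=
  if m is m'.+1 then
    [seq f :: t | f : A <- [seq 'X^e + rVpoly u | e <- iota 0 d, u <- enum {: 'rV[F]_e}],
                  t : seq A <- monic_chains m' (size f).-1]
  else [:: [::]].

Lemma size_XnD_rVpoly e (u : 'rV[F]_e) : size ('X^e + rVpoly u) = e.+1.
Proof. by rewrite size_polyDl size_polyXn // ltnS size_rVpoly. Qed.

Lemma mem_monics d (f : A) :
  (f \in [seq 'X^e + rVpoly u | e <- iota 0 d, u <- enum {: 'rV[F]_e}]) =
  (f \is monic) && (size f <= d)%N.
Proof.
apply/allpairsPdep/andP => [[e [u [e_d _ ->]]]|[f_mon szf]].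
  rewrite mem_iota add0n in e_d; rewrite size_XnD_rVpoly; split=> //.
  by rewrite monicE lead_coefDl ?lead_coefXn // size_polyXn ltnS size_rVpoly.
have szf0 : (0 < size f)%N by rewrite size_poly_gt0 monic_neq0.
exists (size f).-1, (poly_rV (f - 'X^((size f).-1))); split.
- by rewrite mem_iota add0n prednK.
- by rewrite mem_enum.
rewrite poly_rV_K ?subrKC //.
apply/leq_sizeP => k le_k; rewrite coefB coefXn.
have [->|ne_k] := eqVneq k (size f).-1.
  by rewrite -lead_coefE (monicP f_mon) subrr.
by move: le_k; rewrite leq_eqVlt eq_sym (negPf ne_k) prednK // => le_k; rewrite nth_default ?subr0.
Qed.

(** ['X^d] acts as a virtual head of size d + 1, so the path condition also bounds the size of the
    first polynomial by d. *)
Lemma mem_monic_chains m d (t : seq A) : (t \in monic_chains m d) =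
  [&& size t == m, all (fun f : A => f \is monic) t &
      path (fun f g : A => size g < size f)%N 'X^d t].
Proof.
elim: m d t => [|m IHm] d t; first by rewrite inE; case: t.
apply/allpairsPdep/idP => [[f [t' [f_mon t'_in ->]]]|].
  move: f_mon t'_in; rewrite mem_monics IHm => /andP[f_mon szf] /and3P[/eqP <- t'_mon].
  rewrite /= eqxx f_mon t'_mon size_polyXn ltnS szf /=.
  by case: t' {t'_mon} => //= g t'; rewrite size_polyXn prednK ?size_poly_gt0 ?monic_neq0.
case: t => // f t /= /and3P[szt /andP[f_mon t_mon]]; rewrite size_polyXn ltnS => /andP[szf pth].
exists f, t; split=> //; rewrite ?mem_monics ?f_mon // IHm; apply/and3P; split=> //.
by case: t pth {szt t_mon} => //= g t; rewrite size_polyXn prednK ?size_poly_gt0 ?monic_neq0.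
Qed.

Lemma uniq_monic_chains m d : uniq (monic_chains m d).
Proof.
elim: m d => //= m IHm d; apply: allpairs_uniq_dep => //; last by move=> [f t] [g s] _ _ /= [-> ->].
apply: allpairs_uniq_dep => [|e _|[e u] [e' u'] _ _ /= eq_f].
- exact: iota_uniq.
- exact: enum_uniq.
have ee' : e = e'.
  by have := congr1 (fun f : A => size f) eq_f; rewrite /= !size_XnD_rVpoly => -[].
subst e'; congr existT; apply: (can_inj rVpolyK).
exact: addrI eq_f.
Qed.

Lemma sum_monic_chains (C : fieldType) (phi : A -> C) (a : mindex) (d : nat) :
  \sum_(t <- monic_chains (size a) d) (\prod_(fk <- zip t a) phi fk.1 ^+ val fk.2)^-1 =
  Slt phi d a.
Proof.
elim: a d => [|k a IHa] d /=; first by rewrite big_seq1 big_nil invr1.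
have -> : iota 0 d = index_iota 0 d by rewrite /index_iota subn0.
rewrite !big_allpairs_dep big_mkord.
apply: eq_bigr => e _; rewrite /monic_powsum mulr_suml big_enum; apply: eq_bigr => u _.
rewrite size_XnD_rVpoly -IHa mulr_sumr; apply: eq_bigr => t _.
by rewrite /= big_cons /= invfM.
Qed.

End Blocks.

(** * Non-archimedean absolute values *)

Section AbsoluteValue.
Variables (R : realType) (L : fieldType) (v : L -> R).
Hypothesis v_abs : is_absval v.

Lemma absv_ge0 x : 0 <= v x. Proof. by case: v_abs. Qed.

Lemma absv_eq0 x : (v x == 0) = (x == 0).
Proof. by case: v_abs => _ /(_ x)[h1 h2] _ _; apply/eqP/eqP. Qed.

Lemma absv0 : v 0 = 0. Proof. by apply/eqP; rewrite absv_eq0. Qed.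

Lemma absv_gt0 x : (0 < v x) = (x != 0).
Proof. by rewrite lt_def absv_ge0 andbT absv_eq0. Qed.

Lemma absvM x y : v (x * y) = v x * v y. Proof. by case: v_abs. Qed.

Lemma absvD x y : v (x + y) <= Num.max (v x) (v y). Proof. by case: v_abs. Qed.

Lemma absv1 : v 1 = 1.
Proof.
have v1 : v 1 != 0 by rewrite absv_eq0 oner_eq0.
by apply: (mulfI v1); rewrite -absvM !mulr1.
Qed.

Lemma absvX x n : v (x ^+ n) = v x ^+ n.
Proof. by elim: n => [|n IHn]; rewrite ?expr0 ?absv1 // !exprS absvM IHn. Qed.

Lemma absvN x : v (- x) = v x.
Proof.
have v_sq : v (-1) ^+ 2 = 1 by rewrite -absvX sqrrN expr1n absv1.
have vN1 : v (-1) = 1.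
  by apply/eqP; rewrite -(@eqrXn2 _ 2) // ?absv_ge0 // v_sq expr1n.
by rewrite -mulN1r absvM vN1 mul1r.
Qed.

Lemma absv_sub x y : v (x - y) = v (y - x).
Proof. by rewrite -absvN opprB. Qed.

Lemma absvV x : v x^-1 = (v x)^-1.
Proof.
have [->|x0] := eqVneq x 0; first by rewrite !(invr0, absv0).
have vx0 : v x != 0 by rewrite absv_eq0.
by apply: (mulfI vx0); rewrite -absvM !divff // absv1.
Qed.

Lemma absvD_le x y B : v x <= B -> v y <= B -> v (x + y) <= B.
Proof. by move=> hx hy; apply: le_trans (absvD x y) _; rewrite ge_max hx hy. Qed.

Lemma absvB_le x y B : v x <= B -> v y <= B -> v (x - y) <= B.
Proof. by move=> hx hy; apply: absvD_le; rewrite ?absvN. Qed.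

Lemma absv_sum_le (I : Type) (s : seq I) (P : pred I) (f : I -> L) B :
  0 <= B -> (forall i, P i -> v (f i) <= B) -> v (\sum_(i <- s | P i) f i) <= B.
Proof.
move=> B0 fB; apply: (big_ind (fun x => v x <= B)) => //; first by rewrite absv0.
by move=> x y; apply: absvD_le.
Qed.

Lemma absv_nat n : v n%:R <= 1.
Proof.
elim: n => [|n IHn]; first by rewrite absv0 ler01.
by rewrite -natr1 absvD_le ?absv1.
Qed.

Lemma absv_small_eq0 x : (forall e : R, 0 < e -> v x <= e) -> x = 0.
Proof.
move=> xe; apply/eqP; rewrite -absv_eq0 eq_le absv_ge0 andbT.
by apply/ler_addgt0Pl => e e0; rewrite addr0 xe.
Qed.

Lemma seq_lim_unique u l l' : seq_lim v u l -> seq_lim v u l' -> l = l'.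
Proof.
move=> ul ul'; apply/eqP; rewrite -subr_eq0; apply/eqP/absv_small_eq0 => e e0.
have [N uN] := ul e e0; have [N' uN'] := ul' e e0; pose n := maxn N N'.
have -> : l - l' = (u n - l') - (u n - l) by ring.
by apply: absvB_le; apply: ltW; [apply: uN' | apply: uN]; rewrite ?leq_maxl ?leq_maxr.
Qed.

Lemma seq_limM u u' l l' : seq_lim v u l -> seq_lim v u' l' ->
  seq_lim v (fun n => u n * u' n) (l * l').
Proof.
move=> ul ul' e e0; pose B := 1 + v l + v l'.
have B0 : 0 < B by rewrite /B -addrA ltr_pwDl ?addr_ge0 ?absv_ge0.
have B1 : 1 <= B by rewrite /B -addrA lerDl addr_ge0 ?absv_ge0.
(* The 1 in the minimum keeps v (u' n) below B; the e / B makes both error terms smaller than e. *)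
have eB : 0 < Num.min 1 (e / B) by rewrite lt_min ltr01 divr_gt0.
have [N uN] := ul _ eB; have [N' uN'] := ul' _ eB; exists (maxn N N') => n.
rewrite geq_max => /andP[/uN + /uN']; rewrite !lt_min => /andP[_ un] /andP[un1 un'].
have -> : u n * u' n - l * l' = (u n - l) * u' n + l * (u' n - l') by ring.
have u'B : v (u' n) <= B.
  rewrite -[u' n](subrK l'); apply: absvD_le; first by rewrite (le_trans (ltW un1)).
  by rewrite /B lerDr addr_ge0 ?absv_ge0.
have lB : v l <= B by rewrite /B addrAC lerDr addr_ge0 ?absv_ge0.
apply: (le_lt_trans (absvD _ _)); rewrite gt_max !absvM; apply/andP; split.
  rewrite ltr_pdivlMr // in un; apply: le_lt_trans un.
  by rewrite ler_wpM2l ?absv_ge0.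
rewrite ltr_pdivlMr // in un'; apply: le_lt_trans un'.
by rewrite mulrC ler_wpM2l ?absv_ge0.
Qed.

End AbsoluteValue.

Section PolynomialAbsoluteValue.
Variables (R : realType) (F : finFieldType).

(** [absK] uses a chosen representative of the fraction; its numerator is f times its denominator,
    so the degree difference is deg f. *)
Lemma absK_tofrac (f : {poly F}) : absK R (FracField.tofrac f) =
  if f == 0 then 0 else #|F|%:R ^+ (size f).-1.
Proof.
rewrite /absK; set u := repr _.
have uE : \n_u = f * \d_u.
  have := FracField.equivf_l (Ratio f 1); rewrite !numden_Ratio ?oner_eq0 // mulr1 mulrC.
  by rewrite /u piE mulrC.
have d0 : \d_u != 0 by apply: denom_ratioP.
have q0 : #|F|%:R != 0 :> R by rewrite pnatr_eq0 -lt0n (ltnW (finNzRing_gt1 F)).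
rewrite uE mulf_eq0 (negPf d0) orbF; case: eqVneq => // f0.
have sz_f : (0 < size f)%N by rewrite size_poly_gt0.
have sz_d : (0 < size \d_u)%N by rewrite size_poly_gt0.
have -> : (size (f * \d_u)).-1 = ((size f).-1 + (size \d_u).-1)%N.
  by rewrite size_mul // -(prednK sz_f) -(prednK sz_d) addSn addnS.
by rewrite exprD mulfK // expf_neq0.
Qed.

End PolynomialAbsoluteValue.

(** * Lower bounds for linear forms over a complete field *)

Section NormEquivalence.
Variables (R : realType) (K C : fieldType) (j : {rmorphism K -> C}).
Variables (vK : K -> R) (vC : C -> R).
Hypotheses (vK_abs : is_absval vK) (vC_abs : is_absval vC).
Hypothesis v_j : forall x, vC (j x) = vK x.
Hypothesis K_complete : forall u, cauchy_seq vK u -> exists l, seq_lim vK u l.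

Definition lincomb (z : nat -> C) (n : nat) (c : nat -> K) : C :=
  \sum_(i < n) j (c i) * z i.

Lemma lincombB z n c d :
  lincomb z n (fun i => c i - d i) = lincomb z n c - lincomb z n d.
Proof. by rewrite /lincomb -sumrB; apply: eq_bigr => i _; rewrite rmorphB mulrBl. Qed.

Lemma lincombZ z n a c : lincomb z n (fun i => a * c i) = j a * lincomb z n c.
Proof. by rewrite /lincomb mulr_sumr; apply: eq_bigr => i _; rewrite rmorphM mulrA. Qed.

(** The lower bound makes the coordinates of approximating combinations Cauchy; their limits in K
    are the coordinates of x. *)
Lemma lincomb_closed (z : nat -> C) (n : nat) (delta : R) (x : C) : 0 < delta ->
  (forall c i, (i < n)%N -> delta * vK (c i) <= vC (lincomb z n c)) ->
  (forall e : R, 0 < e -> exists c, vC (x - lincomb z n c) < e) ->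
  exists c, x = lincomb z n c.
Proof.
move=> delta0 deltaP approx.
have inv0 (k : nat) : 0 < k.+1%:R^-1 :> R by rewrite invr_gt0 ltr0n.
have [c cP] := choice (fun k => approx _ (inv0 k)).
have small (e : R) : 0 < e -> exists N, forall k, (N <= k)%N -> vC (x - lincomb z n (c k)) < e.
  move=> e0; pose N := Num.bound e^-1; exists N => k le_Nk.
  apply: lt_trans (cP k) _; rewrite -[e]invrK ltf_pV2 ?posrE ?invr_gt0 ?ltr0n //.
  have eV0 : 0 <= e^-1 by rewrite invr_ge0 ltW.
  by apply: lt_le_trans (archi_boundP eV0) _; rewrite ler_nat leqW.
have coord_lim i : exists l, (i < n)%N -> seq_lim vK (fun k => c k i) l.
  case: (ltnP i n) => [lt_in|_]; last by exists 0.
  suff /K_complete[l lP] : cauchy_seq vK (fun k => c k i) by exists l.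
  move=> e e0; have [N NP] := small (delta * e) (mulr_gt0 delta0 e0).
  exists N => k l le_k le_l; rewrite -(ltr_pM2l delta0).
  apply: le_lt_trans (deltaP (fun i => c k i - c l i) i lt_in) _.
  have -> : lincomb z n (fun i => c k i - c l i) =
      (x - lincomb z n (c l)) - (x - lincomb z n (c k)).
    by rewrite lincombB; ring.
  apply: (le_lt_trans (absvD vC_abs _ _)).
  by rewrite (absvN vC_abs) gt_max !NP.
have [l lP] := choice coord_lim; exists l; apply/eqP; rewrite -subr_eq0; apply/eqP.
apply: (absv_small_eq0 vC_abs) => e e0.
have close (i : nat) : exists N, (i < n)%N ->
    forall k, (N <= k)%N -> vC (j (c k i - l i) * z i) <= e.
  case: (ltnP i n) => [lt_in|_]; last by exists 0%N.
  have [z0|z0] := eqVneq (z i) 0.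
    by exists 0%N => _ k _; rewrite z0 mulr0 (absv0 vC_abs) ltW.
  have vz0 : 0 < vC (z i) by rewrite (absv_gt0 vC_abs).
  have [N NP] := lP i lt_in (e / vC (z i)) (divr_gt0 e0 vz0).
  exists N => _ k /NP; rewrite (absvM vC_abs) v_j => /ltW.
  by rewrite ler_pdivlMr.
have [N NP] := choice close; have [N' N'P] := small e e0.
pose k := maxn N' (\max_(i < n) N i).
have -> : x - lincomb z n l = (x - lincomb z n (c k)) + lincomb z n (fun i => c k i - l i).
  by rewrite lincombB; ring.
apply: (absvD_le vC_abs); first by rewrite ltW // N'P // leq_maxl.
apply: (absv_sum_le vC_abs) => [|i _]; first exact: ltW.
by apply: NP => //; apply: leq_trans (leq_maxr _ _); apply: leq_bigmax.
Qed.

(* The span of z_0, ..., z_(n-1) is closed by completeness of K, so z_n has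
   positive distance to it. *)
Lemma lincomb_lower_bound (z : nat -> C) (n : nat) :
  (forall c, lincomb z n c = 0 -> forall i, (i < n)%N -> c i = 0) ->
  exists2 delta : R, 0 < delta &
    forall c i, (i < n)%N -> delta * vK (c i) <= vC (lincomb z n c).
Proof.
elim: n => [|n IHn] indep; first by exists 1.
have ext c x : lincomb z n.+1 (fun i => if (i < n)%N then c i else x) =
    lincomb z n c + j x * z n.
  rewrite /lincomb big_ord_recr /= ltnn; congr (_ + _).
  by apply: eq_bigr => i _; rewrite ltn_ord.
have [|d d0 dP] := IHn.
  move=> c c0 i lt_in; pose c' i := if (i < n)%N then c i else 0.
  have := indep c' _ i (ltnW lt_in); rewrite /c' lt_in; apply.
  by rewrite ext c0 rmorph0 mul0r addr0.
(* Without such an eta, z_n would lie in the span of its predecessors, and the coefficients (c, -1)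
   would contradict independence. *)
have [eta eta0 etaP] : exists2 eta : R, 0 < eta & forall c, eta <= vC (z n - lincomb z n c).
  apply: contrapT => no_eta.
  have [c zE] : exists c, z n = lincomb z n c.
    apply: (lincomb_closed d0 dP) => e e0; apply: contrapT => no_c; apply: no_eta.
    by exists e => // c; rewrite leNgt; apply/negP => lt_e; apply: no_c; exists c.
  have := indep (fun i => if (i < n)%N then c i else -1) _ n (ltnSn n).
  rewrite ltnn ext -zE rmorphN1 mulN1r subrr => /(_ erefl) /eqP.
  by rewrite oppr_eq0 oner_eq0.
pose B := Num.max 1 (vC (z n) / eta).
have B1 : 1 <= B by rewrite le_max lexx.
have B0 : 0 < B by apply: lt_le_trans B1.
(* The bound eta serves the last coordinate. For the others, the partial combination s satisfies |s|
   <= B |T|, which turns the inductive constant d into d / B. *)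
exists (Num.min eta (d / B)); first by rewrite lt_min eta0 divr_gt0.
move=> c i; set T := lincomb z n.+1 c; set s := lincomb z n c.
have TE : T = s + j (c n) * z n by rewrite /T /lincomb big_ord_recr.
have last_le : eta * vK (c n) <= vC T.
  have [->|cn0] := eqVneq (c n) 0; first by rewrite (absv0 vK_abs) mulr0 (absv_ge0 vC_abs).
  have -> : T = j (c n) * (z n - lincomb z n (fun i => - (c n)^-1 * c i)).
    rewrite TE lincombZ mulrBr mulrA -rmorphM mulrN divff // rmorphN1 -/s; ring.
  by rewrite (absvM vC_abs) v_j mulrC ler_wpM2l ?(absv_ge0 vK_abs).
have s_le : vC s <= B * vC T.
  have -> : s = T - j (c n) * z n by rewrite TE addrK.
  apply: (absvB_le vC_abs); first by rewrite ler_peMl ?(absv_ge0 vC_abs).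
  rewrite (absvM vC_abs) v_j.
  apply: (@le_trans _ _ (vC (z n) / eta * vC T)); last first.
    by rewrite ler_wpM2r ?(absv_ge0 vC_abs) // le_max lexx orbT.
  rewrite mulrAC -mulrA [vK _ * _]mulrC ler_wpM2l ?(absv_ge0 vC_abs) //.
  by rewrite ler_pdivlMr // mulrC.
rewrite ltnS leq_eqVlt => /orP[/eqP ->|lt_in].
  by apply: le_trans last_le; rewrite ler_wpM2r ?(absv_ge0 vK_abs) // ge_min lexx.
apply: (@le_trans _ _ (d / B * vK (c i))).
  by rewrite ler_wpM2r ?(absv_ge0 vK_abs) // ge_min lexx orbT.
by rewrite mulrAC ler_pdivrMr // (le_trans (dP c i lt_in)) // mulrC.
Qed.

End NormEquivalence.

(** * Convergence of the truncations *)

Section Truncation.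
Variables (R : realType) (F : finFieldType) (M : Cinf_model R F) (r : nat).
Local Notation K := (Kinf M).
Local Notation C := (Cinf M).
Local Notation A := {poly F}.
Local Notation q := (#|F|%:R : R).

Lemma vKinf_absval : is_absval (@vKinf R F M).
Proof. by case: (Kinf_completion M). Qed.

Lemma vC_absval : is_absval (@vC R F M).
Proof. by case: (Cinf_completion M). Qed.

Lemma vC_ofKinf (x : K) : vC (ofKinf x) = vKinf x.
Proof. by case: (Cinf_completion M) => _ h _ _; rewrite /ofKinf h vKbar_extends. Qed.

Definition of_const : {rmorphism F -> C} :=
  (iC M \o (iKbar M \o (iKinf M \o (@FracField.tofrac A \o @polyC F)))).

Definition of_Kinf_morph : {rmorphism K -> C} := (iC M \o iKbar M).

Lemma q_ge1 : 1 <= q.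
Proof. by rewrite ler1n ltnW // finNzRing_gt1. Qed.

Lemma q_gt0 : 0 < q. Proof. exact: lt_le_trans ltr01 q_ge1. Qed.

Lemma vKinf_poly (f : A) :
  vKinf (iKinf M (FracField.tofrac f)) = if f == 0 then 0 else q ^+ (size f).-1.
Proof. by case: (Kinf_completion M) => _ h _ _; rewrite h absK_tofrac. Qed.

Definition lower_bound (delta : R) (z : Omega M r) : Prop :=
  forall (c : 'rV[K]_r) i, delta * vKinf (c 0 i) <= vC (linform c z).

Lemma lower_boundW (d e : R) z : e <= d -> lower_bound d z -> lower_bound e z.
Proof.
move=> le_ed dP c i; apply: le_trans (dP c i).
by rewrite ler_wpM2r // absv_ge0 //; apply: vKinf_absval.
Qed.

Lemma Omega_lower_bound (z : Omega M r) : exists2 d : R, 0 < d & lower_bound d z.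
Proof.
pose zn k := if insub k is Some i then z 0 (i : 'I_r) else 0 : C.
have linE (c : 'rV[K]_r) (cn : nat -> K) : (forall i : 'I_r, cn i = c 0 i) ->
    lincomb of_Kinf_morph zn r cn = linform c z.
  by move=> cE; apply: eq_bigr => i _; rewrite cE /zn valK.
have [K_abs _ K_compl _] := Kinf_completion M.
have [|d d0 dP] := lincomb_lower_bound (j := of_Kinf_morph) K_abs vC_absval
  vC_ofKinf K_compl (z := zn) (n := r).
  move=> cn cn0 i lt_ir.
  have c0 : (\row_(i < r) cn i) = 0.
    by apply: (coords_indep (o := z)); rewrite -(linE _ cn) // => k; rewrite mxE.
  by have /rowP/(_ (Ordinal lt_ir)) := c0; rewrite !mxE.
exists d => // c i; pose cn k := if insub k is Some i then c 0 (i : 'I_r) else 0 : K.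
have cnE (k : 'I_r) : cn k = c 0 k by rewrite /cn valK.
by rewrite -(linE c cn) // -cnE; apply: dP.
Qed.

Lemma Omega_n_lower_bound (n : nat) (z : Omega M r) : (0 < r)%N ->
  Omega_n n z -> lower_bound (q ^- n) z.
Proof.
move=> r0; rewrite /Omega_n /hdist; set zm := \big[_/_]_(i < r) _; set S := [set _ | _]%classic.
move=> zn c i.
have K_abs := vKinf_absval.
pose i0 := [arg max_(k > i) vKinf (c 0 k)]%O.
have i0P k : vKinf (c 0 k) <= vKinf (c 0 i0).
  by rewrite /i0; case: arg_maxP => // k' _; apply.
have [c0|c0] := eqVneq (c 0 i0) 0.
  have := i0P i; rewrite c0 (absv0 K_abs) => v_le0.
  have -> : vKinf (c 0 i) = 0 by apply/eqP; rewrite eq_le v_le0 (absv_ge0 K_abs).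
  by rewrite mulr0 (absv_ge0 vC_absval).
have zm1 : 1 <= zm.
  have lt_r : (r.-1 < r)%N by rewrite prednK.
  have := coords_last z (i := Ordinal lt_r); rewrite /= prednK // => /(_ erefl) z1.
  by rewrite -(absv1 vC_absval) -z1; apply: le_bigmax.
have v0 : 0 < vKinf (c 0 i0) by rewrite (absv_gt0 K_abs).
pose c' := (c 0 i0)^-1 *: c.
have linZ : linform c z = ofKinf (c 0 i0) * linform c' z.
  rewrite /linform mulr_sumr; apply: eq_bigr => k _; rewrite mxE /ofKinf !rmorphM.
  by rewrite !fmorphV !mulrA divff ?mul1r // !fmorph_eq0.
have S_c' : S (vC (linform c' z)).
  exists c'; split => //; apply/eqP; rewrite eq_le; apply/andP; split.
    apply: bigmax_le => // k _; rewrite mxE (absvM K_abs) (absvV K_abs) mulrC.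
    by rewrite ler_pdivrMr // mul1r.
  apply: le_trans (le_bigmax _ _ i0); rewrite mxE mulVf // (absv1 K_abs).
  exact: lexx.
have inf_le : inf S <= vC (linform c' z).
  by apply: ge_inf => //; exists 0 => _ [d [_ ->]]; apply: (absv_ge0 vC_absval).
have c'_ge : q ^- n <= vC (linform c' z).
  apply: le_trans inf_le; rewrite -[q ^- n]mulr1.
  apply: (@le_trans _ _ (q ^- n * zm)); first by rewrite ler_wpM2l // invr_ge0 exprn_ge0 // ler0n.
  rewrite -ler_pdivlMr 1?mulrC //; exact: lt_le_trans ltr01 zm1.
rewrite linZ (absvM vC_absval) vC_ofKinf mulrC.
by apply: ler_pM; rewrite ?(absv_ge0 K_abs) // invr_ge0 exprn_ge0 // ler0n.
Qed.

Definition row_Kinf (f : 'rV[A]_r) : 'rV[K]_r :=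
  \row_i iKinf M (FracField.tofrac (f 0 i)).

Lemma pairingE (f : 'rV[A]_r) (z : Omega M r) : pairing f z = linform (row_Kinf f) z.
Proof. by apply: eq_bigr => i _; rewrite mxE. Qed.

Lemma pairingP c (f g : 'rV[A]_r) (z : Omega M r) :
  pairing (c%:P *: f + g) z = of_const c * pairing f z + pairing g z.
Proof.
rewrite /pairing mulr_sumr -big_split; apply: eq_bigr => i _ /=.
by rewrite !mxE /ofA /ofKinf !rmorphD !rmorphM mulrDl -mulrA.
Qed.

Lemma pairing_neq0 (f : 'rV[A]_r) (z : Omega M r) : f != 0 -> pairing f z != 0.
Proof.
apply: contraNneq; rewrite pairingE => /coords_indep /rowP f0.
apply/eqP/rowP => i; have := f0 i; rewrite !mxE => /eqP.
by rewrite fmorph_eq0 tofrac_eq0 => /eqP.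
Qed.

Lemma vC_pairing_ge d (z : Omega M r) (f : 'rV[A]_r) (i : 'I_r) : lower_bound d z ->
  d * (if f 0 i == 0 then 0 else q ^+ (size (f 0%R i)).-1) <= vC (pairing f z).
Proof. by move=> dP; rewrite pairingE -vKinf_poly; have := dP (row_Kinf f) i; rewrite mxE. Qed.

(** A nonzero coordinate has absolute value at least 1, and outside the box some coordinate has
    degree at least N. *)
Lemma vC_pairing_inv_le N d (z : Omega M r) (f : 'rV[A]_r) :
  0 < d -> lower_bound d z -> succ0 f ->
  vC (pairing f z)^-1 <= d^-1 * (if in_box N f then 1 else q ^- N).
Proof.
move=> d0 dP f_pos; rewrite (absvV vC_absval).
suff [i fi0 N_le] : exists2 i, f 0 i != 0 & (~~ in_box N f -> (N < size (f 0%R i))%N).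
  have := vC_pairing_ge f i dP; rewrite (negPf fi0) => pair_ge.
  have low : 0 < d * q ^+ (size (f 0%R i)).-1 by rewrite mulr_gt0 // exprn_gt0 // q_gt0.
  have pair0 : 0 < vC (pairing f z) by apply: lt_le_trans pair_ge.
  apply: (@le_trans _ _ (d * q ^+ (size (f 0%R i)).-1)^-1); first by rewrite lef_pV2.
  rewrite invfM ler_wpM2l ?invr_ge0 ?(ltW d0) //; case: ifPn => [_|/N_le lt_N].
    by rewrite invf_le1 ?exprn_gt0 ?q_gt0 // exprn_ege1 // q_ge1.
  rewrite lef_pV2 ?posrE ?exprn_gt0 ?q_gt0 // ler_weXn2l ?q_ge1 //.
  by rewrite -ltnS prednK // size_poly_gt0.
have [/forallP|/existsP[i szi]] := boolP [forall i, (size (f 0%R i) <= N)%N]; last first.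
  by exists i => [|_]; rewrite ?ltnNge // -size_poly_gt0; case: (size _) szi.
have /existsP[i /andP[_ f_mon]] := f_pos.
by exists i; rewrite ?monic_neq0 // /in_box => /negP; case; apply/forallP.
Qed.

Definition Eis_dom (a : mindex) (fs : seq 'rV[A]_r) : bool :=
  [&& size fs == size a, sorted (@succ F r) fs & all (@succ0 F r) fs].

Definition Eis_term (a : mindex) (z : Omega M r) (fs : seq 'rV[A]_r) : C :=
  (\prod_(fa <- zip fs a) pairing fa.1 z ^+ val fa.2)^-1.

Definition weight (a : mindex) : nat := \sum_(k <- a) val k.

(** The bounds of the factors multiply, and a single vector outside the box already contributes
    q^-N. *)
Lemma Eis_term_le N d (z : Omega M r) a fs : 0 < d -> d <= 1 -> lower_bound d z ->
  size fs = size a -> all (@succ0 F r) fs ->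
  vC (Eis_term a z fs) <= d^-1 ^+ weight a * (if all (in_box N) fs then 1 else q ^- N).
Proof.
move=> d0 d1 dP; elim: fs a => [|f fs IHfs] [|k a] //=.
  by rewrite /Eis_term /weight !big_nil invr1 (absv1 vC_absval) mulr1.
move=> [/IHfs{}IHfs] /andP[f_pos /IHfs{}IHfs].
have qN0 : 0 <= q ^- N by rewrite invr_ge0 exprn_ge0 // ler0n.
have qN1 : q ^- N <= 1 by rewrite invf_le1 ?exprn_gt0 ?q_gt0 // exprn_ege1 // q_ge1.
have D0 : 0 <= d^-1 by rewrite invr_ge0 ltW.
have box01 (b : bool) : 0 <= (if b then 1 else q ^- N) <= 1.
  by case: b; rewrite ?ler01 ?lexx ?qN0.
rewrite /Eis_term /weight /= !big_cons invfM (absvM vC_absval) exprD -/(weight a).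
have head_le : vC (pairing f z ^+ val k)^-1 <= d^-1 ^+ val k * (if in_box N f then 1 else q ^- N).
  rewrite -exprVn (absvX vC_absval).
  apply: (@le_trans _ _ ((d^-1 * (if in_box N f then 1 else q ^- N)) ^+ val k)).
    rewrite lerXn2r ?nnegrE ?(absv_ge0 vC_absval) ?vC_pairing_inv_le // mulr_ge0 //.
    by case/andP: (box01 (in_box N f)).
  rewrite exprMn ler_wpM2l ?exprn_ge0 //.
  have /andP[b0 b1] := box01 (in_box N f).
  (* The exponent is at least 1 and the base lies in [0, 1]. *)
  by rewrite -[X in _ <= X]expr1 ler_wiXn2l // (valP k).
apply: (@le_trans _ _ (d^-1 ^+ val k * (if in_box N f then 1 else q ^- N) *
   (d^-1 ^+ weight a * (if all (in_box N) fs then 1 else q ^- N)))).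
  by apply: ler_pM => //; apply: (absv_ge0 vC_absval).
rewrite mulrACA ler_wpM2l ?mulr_ge0 ?exprn_ge0 //.
case: (in_box N f); rewrite ?mul1r //=.
by case: (all _ _); rewrite ?mulr1 // ler_piMr.
Qed.

(** This is the map to which the results on power sums are applied, with m = r * N. *)
Definition trunc_phi (N : nat) (z : Omega M r) (p : A) : C := pairing (split_blocks r N p) z.

Lemma trunc_phiP N z c (f g : A) :
  trunc_phi N z (c *: f + g) = of_const c * trunc_phi N z f + trunc_phi N z g.
Proof. by rewrite /trunc_phi split_blocksP pairingP. Qed.

Lemma trunc_phi_neq0 N z (f : A) : f != 0 -> (size f <= r * N)%N -> trunc_phi N z f != 0.
Proof. by move=> f0 szf; rewrite pairing_neq0 // split_blocks_neq0. Qed.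

Definition Eis_trunc (N : nat) (a : mindex) (z : Omega M r) : C :=
  Slt (trunc_phi N z) (r * N) a.

Definition box_chains (N : nat) (a : mindex) : seq (seq 'rV[A]_r) :=
  [seq map (split_blocks r N) t | t <- monic_chains F (size a) (r * N)].

Lemma chains_monic_size N m (t : seq A) : t \in monic_chains F m (r * N) ->
  all (fun f : A => (f \is monic) && (size f <= r * N)%N) t.
Proof.
rewrite mem_monic_chains => /and3P[_ t_mon].
rewrite (path_sortedE (leT := fun f g : A => (size g < size f)%N)); last first.
  by move=> f g h; apply: [eta fun h1 h2 => ltn_trans h2 h1].
case/andP => /allP t_sz _; apply/allP => f ft.
rewrite (allP t_mon) //=; have := t_sz f ft; by rewrite size_polyXn ltnS.
Qed.

Lemma sorted_split N (t : seq A) :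
  all (fun f : A => (f \is monic) && (size f <= r * N)%N) t ->
  sorted (@succ F r) (map (split_blocks r N) t) =
  sorted (fun f g : A => (size g < size f)%N) t.
Proof.
move=> t_ok; rewrite sorted_map; apply: eq_in_sorted t_ok => f g.
by move=> /andP[fm szf] /andP[gm szg]; apply: succ_split.
Qed.

(** [split_blocks] and [join_blocks] match the chains of monic polynomials of size at most r * N
    with the chains of positive vectors in the box. *)
Lemma mem_box_chains N a fs : (fs \in box_chains N a) = Eis_dom a fs && all (in_box N) fs.
Proof.
apply/mapP/andP => [[t t_in ->]|[/and3P[sz_fs fs_sorted fs_pos] fs_box]].
  have t_ok := chains_monic_size t_in.
  move: t_in; rewrite mem_monic_chains => /and3P[sz_t t_mon t_path].
  split; last by rewrite all_map; apply/allP => f _; apply: in_box_split.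
  rewrite /Eis_dom size_map sz_t sorted_split // (path_sorted t_path) /= all_map.
  by apply: sub_all t_ok => f /andP[fm szf] /=; rewrite succ0_split.
exists (map (@join_blocks F r N) fs); last first.
  rewrite -map_comp map_id_in // => f ffs /=.
  by rewrite join_blocksK // (allP fs_box).
have t_ok : all (fun f : A => (f \is monic) && (size f <= r * N)%N) (map (@join_blocks F r N) fs).
  rewrite all_map; apply/allP => f ffs /=; have f_box := allP fs_box _ ffs.
  rewrite size_join_blocks // andbT -(@succ0_split F r N) ?size_join_blocks //.
  by rewrite join_blocksK // (allP fs_pos).
rewrite mem_monic_chains size_map sz_fs /=; apply/andP; split.
  by apply: sub_all t_ok => f /andP[].
rewrite path_sortedE; last by move=> f g h h1 h2; apply: ltn_trans h2 h1.
apply/andP; split; first by apply: sub_all t_ok => f /andP[_ szf]; rewrite size_polyXn ltnS.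
rewrite -(@sorted_split N) // -map_comp map_id_in // => f ffs /=.
by rewrite join_blocksK // (allP fs_box).
Qed.

Lemma uniq_box_chains N a : uniq (box_chains N a).
Proof.
rewrite map_inj_in_uniq ?uniq_monic_chains // => t s.
move=> /chains_monic_size t_ok /chains_monic_size s_ok.
elim: t s t_ok s_ok => [|f t IHt] [|g s] //= /andP[/andP[_ szf] t_ok].
move=> /andP[/andP[_ szg] s_ok] [eq_fg eq_ts].
by rewrite (split_blocks_inj szf szg eq_fg) (IHt s).
Qed.

Lemma Eis_truncE N a z : Eis_trunc N a z = \sum_(fs <- box_chains N a) Eis_term a z fs.
Proof.
rewrite /Eis_trunc -sum_monic_chains big_map; apply: eq_bigr => t _.
congr (_^-1); elim: t (a) => [|f t IHt] [|k b] /=; rewrite ?big_nil // !big_cons /=.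
by rewrite IHt.
Qed.

(** Only terms with a vector outside the box remain, and the ultrametric inequality bounds their sum
    however many there are. *)
Lemma box_sum_approx N a (z : Omega M r) d (J : {fset seq 'rV[A]_r}) :
  0 < d -> d <= 1 -> lower_bound d z -> {subset box_chains N a <= J} ->
  vC (\sum_(fs <- J | Eis_dom a fs) Eis_term a z fs - Eis_trunc N a z)
    <= d^-1 ^+ weight a * q ^- N.
Proof.
move=> d0 d1 dP sub_J; rewrite Eis_truncE (bigID (all (in_box N))) /=.
have -> : \sum_(fs <- J | Eis_dom a fs && all (in_box N) fs) Eis_term a z fs =
    \sum_(fs <- box_chains N a) Eis_term a z fs.
  rewrite -big_filter; apply: perm_big; apply: uniq_perm.
  - by rewrite filter_uniq // fset_uniq.
  - exact: uniq_box_chains.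
  move=> fs; rewrite mem_filter -mem_box_chains andb_idr //; exact: sub_J.
rewrite addrAC subrr add0r; apply: (absv_sum_le vC_absval).
  by rewrite mulr_ge0 ?invr_ge0 ?exprn_ge0 ?ler0n // invr_ge0 ltW.
move=> fs /andP[/and3P[/eqP sz_fs _ fs_pos] fs_box].
by have := Eis_term_le N d0 d1 dP sz_fs fs_pos; rewrite (negPf fs_box).
Qed.

Lemma qN_small (e B : R) : 0 < e -> 0 < B ->
  exists N0 : nat, forall N, (N0 <= N)%N -> B * q ^- N < e.
Proof.
move=> e0 B0; have Be0 : 0 <= B / e by rewrite divr_ge0 ?ltW.
exists (Num.bound (B / e)) => N le_N.
rewrite ltr_pdivrMr ?exprn_gt0 ?q_gt0 // -ltr_pdivrMl // mulrC.
apply: lt_le_trans (archi_boundP Be0) _; apply: (@le_trans _ _ N%:R); first by rewrite ler_nat.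
rewrite -natrX ler_nat; apply: ltnW; apply: ltn_expl; exact: finNzRing_gt1.
Qed.

(** The truncations form a Cauchy sequence whose limit is an unordered sum. Hence [infsum] is not
    the default value 0, and the error is read off from one large finite set of chains. *)
Lemma Eis_approx N a (z : Omega M r) d : 0 < d -> d <= 1 -> lower_bound d z ->
  vC (Eis a z - Eis_trunc N a z) <= d^-1 ^+ weight a * q ^- N.
Proof.
move=> d0 d1 dP.
have D0 : 0 <= d^-1 ^+ weight a by rewrite exprn_ge0 // invr_ge0 ltW.
have B0 : 0 < d^-1 ^+ weight a by rewrite exprn_gt0 // invr_gt0.
have err0 n : 0 < d^-1 ^+ weight a * q ^- n by rewrite mulr_gt0 // invr_gt0 exprn_gt0 // q_gt0.
case: a => [|k a] in D0 B0 err0 *.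
  by rewrite /= /Eis_trunc /= subrr (absv0 vC_absval) ltW.
set a' := k :: a in D0 B0 err0 *.
pose Jn n : {fset seq 'rV[A]_r} := [fset fs in box_chains n a']%fset.
have subJ n (J : {fset seq 'rV[A]_r}) : (Jn n `<=` J)%fset -> {subset box_chains n a' <= J}.
  by move=> /fsubsetP sub fs fsn; apply: sub; rewrite in_fset.
(* Both truncations are compared with the sum over the union of their chains. *)
have sums_approx n n' : vC (Eis_trunc n a' z - Eis_trunc n' a' z) <=
    d^-1 ^+ weight a' * q ^- minn n n'.
  pose J := (Jn n `|` Jn n')%fset.
  have le_min m : (minn n n' <= m)%N ->
      d^-1 ^+ weight a' * q ^- m <= d^-1 ^+ weight a' * q ^- minn n n'.
    move=> le_m; rewrite ler_wpM2l // lef_pV2 ?posrE ?exprn_gt0 ?q_gt0 //.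
    by rewrite ler_weXn2l // q_ge1.
  have h := box_sum_approx d0 d1 dP (subJ n J (fsubsetUl _ _)).
  have h' := box_sum_approx d0 d1 dP (subJ n' J (fsubsetUr _ _)).
  set S := \sum_(fs <- J | _) _ in h h'.
  have -> : Eis_trunc n a' z - Eis_trunc n' a' z =
      (S - Eis_trunc n' a' z) - (S - Eis_trunc n a' z) by ring.
  apply: (absvB_le vC_absval); [apply: le_trans h' _ | apply: le_trans h _].
    by rewrite le_min ?geq_minr.
  by rewrite le_min ?geq_minl.
have [s sP] : exists s, seq_lim (@vC R F M) (fun n => Eis_trunc n a' z) s.
  have [_ _ complete _] := Cinf_completion M; apply: complete => e e0.
  have [N0 N0P] := qN_small e0 B0; exists N0 => m n le_m le_n.
  by apply: le_lt_trans (sums_approx m n) _; rewrite N0P // leq_min le_m.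
have s_sum : has_sum (Eis_dom a') (Eis_term a' z) s.
  move=> e e0; have [N0 N0P] := qN_small e0 B0; have [N1 N1P] := sP e e0.
  pose n := maxn N0 N1; exists (Jn n) => J sub_J.
  have -> : \sum_(fs <- J | Eis_dom a' fs) Eis_term a' z fs - s =
    (\sum_(fs <- J | Eis_dom a' fs) Eis_term a' z fs - Eis_trunc n a' z) +
    (Eis_trunc n a' z - s) by ring.
  apply: le_lt_trans (absvD vC_absval _ _) _; rewrite gt_max N1P ?leq_maxr // andbT.
  apply: le_lt_trans (box_sum_approx d0 d1 dP (subJ n J sub_J)) _.
  by rewrite N0P // leq_maxl.
have E_sum : has_sum (Eis_dom a') (Eis_term a' z) (Eis a' z).
  pose sums := [set s | has_sum (Eis_dom a') (Eis_term a' z) s]%classic.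
  by rewrite /Eis /a' /infsum; apply: (@xgetPex _ 0 sums); exists s.
(* The set J0 makes the finite sum close to [Eis], and adding [Jn N] makes it close to the
   truncation. *)
have [J0 J0P] := E_sum _ (err0 N).
have J_le := box_sum_approx d0 d1 dP (subJ N _ (fsubsetUr J0 _)).
have := J0P _ (fsubsetUl J0 (Jn N)); set S := \sum_(fs <- _ | _) _ in J_le * => S_lt.
have -> : Eis a' z - Eis_trunc N a' z = (S - Eis_trunc N a' z) - (S - Eis a' z) by ring.
by apply: (absvB_le vC_absval) => //; apply: ltW.
Qed.

End Truncation.

(** * Rigid analyticity and the product formula *)

Section Rational.
Variables (R : realType) (F : finFieldType) (M : Cinf_model R F) (r n : nat).
Local Notation C := (Cinf M).
Local Notation rational := (@rational_without_poles R F M r n).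

Lemma rational_const (c : C) : rational (fun=> c).
Proof.
exists (mpolyC r c), (mpolyC r 1) => z _; rewrite /peval !mevalC oner_neq0 divr1.
by split.
Qed.

Lemma rationalD g h : rational g -> rational h -> rational (fun z => g z + h z).
Proof.
move=> [P [Q gE]] [P' [Q' hE]]; exists (P * Q' + P' * Q), (Q * Q') => z zn.
have [Q0 ->] := gE z zn; have [Q'0 ->] := hE z zn.
rewrite /peval !mevalD !mevalM -!/(peval _ z); split; first by rewrite mulf_neq0.
by rewrite addf_div.
Qed.

Lemma rationalM g h : rational g -> rational h -> rational (fun z => g z * h z).
Proof.
move=> [P [Q gE]] [P' [Q' hE]]; exists (P * P'), (Q * Q') => z zn.
have [Q0 ->] := gE z zn; have [Q'0 ->] := hE z zn.
rewrite /peval !mevalM -!/(peval _ z); split; first by rewrite mulf_neq0.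
by rewrite mulf_div.
Qed.

Lemma rational_sum (I : Type) (s : seq I) (g : I -> Omega M r -> C) :
  (forall i, rational (g i)) -> rational (fun z => \sum_(i <- s) g i z).
Proof.
move=> gP; elim: s => [|i s IHs].
  have [P [Q E]] := rational_const 0; exists P, Q => z zn.
  by rewrite big_nil; apply: E.
have [P [Q E]] := rationalD (gP i) IHs; exists P, Q => z zn.
by rewrite big_cons; apply: E.
Qed.

(** The denominator is a linear form with no zero on Omega, by independence of the coordinates. *)
Lemma rational_pairingV (f : 'rV[{poly F}]_r) : f != 0 ->
  rational (fun z => (pairing f z)^-1).
Proof.
move=> f0; exists (mpolyC r 1), (\sum_(i < r) (mpolyC r (ofA M (f 0 i))) * 'X_i) => z _.
have -> : peval (\sum_(i < r) mpolyC r (ofA M (f 0 i)) * 'X_i) z = pairing f z.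
  rewrite /peval raddf_sum /=; apply: eq_bigr => i _.
  by rewrite mevalM mevalC mevalXU.
by rewrite pairing_neq0 // /peval mevalC mul1r.
Qed.

Lemma rationalX g k : rational g -> rational (fun z => g z ^+ k).
Proof.
move=> gP; elim: k => [|k IHk]; first by apply: rational_const.
have [P [Q E]] := rationalM gP IHk; exists P, Q => z zn.
by rewrite exprS; apply: E.
Qed.

Lemma rational_ext g h : (forall z, g z = h z) -> rational g -> rational h.
Proof. by move=> gh [P [Q E]]; exists P, Q => z /E; rewrite gh. Qed.

Lemma rational_Eis_trunc N a : rational (Eis_trunc N a).
Proof.
(* The summation bound d is freed from r * N so that it can decrease in the induction while
   [trunc_phi] stays fixed. *)
rewrite /Eis_trunc; have := leqnn (r * N)%N; move: {1 3}(r * N)%N => d.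
elim: a d => [|k a IHa] d le_d; first exact: rational_const.
apply: rational_sum => e; apply: rationalM; last first.
  by apply: IHa; apply: leq_trans (ltnW (ltn_ord e)) le_d.
apply: rational_sum => u.
apply: (rational_ext (g := fun z => (trunc_phi N z ('X^e + rVpoly u))^-1 ^+ val k)).
  by move=> z; rewrite exprVn.
apply: rationalX; apply: rational_pairingV; apply: split_blocks_neq0.
  by rewrite -size_poly_gt0 size_XnD_rVpoly.
by rewrite size_XnD_rVpoly; apply: leq_trans (ltn_ord e) le_d.
Qed.

End Rational.

(** * The linear map on words and its multiplicativity *)

Section Ehat.
Variables (R : realType) (F : finFieldType) (M : Cinf_model R F) (r p : nat).
Hypothesis pF : p \in [pchar F].
Local Notation C := (Cinf M).
Local Notation q := (#|F|%:R : R).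

Definition Ehat_trunc (N : nat) (x : words p) (z : Omega M r) : C :=
  \sum_(w <- msupp x) (mcoeff w x : nat)%:R * Eis_trunc N (fmonom_val w) z.

Definition max_weight (x : words p) : nat :=
  \max_(w <- msupp x) weight (fmonom_val w).

Lemma Ehat_approx N (x : words p) (z : Omega M r) d :
  0 < d -> d <= 1 -> lower_bound d z ->
  vC (Ehat x z - Ehat_trunc N x z) <= d^-1 ^+ max_weight x * q ^- N.
Proof.
move=> d0 d1 dP; rewrite /Ehat /Ehat_trunc -sumrB big_seq.
have B0 : 0 <= d^-1 ^+ max_weight x * q ^- N.
  by rewrite mulr_ge0 ?invr_ge0 ?exprn_ge0 ?ler0n // invr_ge0 ltW.
apply: (absv_sum_le (@vC_absval R F M)) => // w wx.
rewrite -mulrBr (absvM (@vC_absval R F M)).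
(* The coefficients are images of natural numbers, hence of absolute value at most 1. *)
apply: le_trans (ler_piMl (absv_ge0 (@vC_absval R F M) _) (absv_nat (@vC_absval R F M) _)) _.
apply: le_trans (Eis_approx N _ d0 d1 dP) _; rewrite ler_wpM2r //.
  by rewrite invr_ge0 exprn_ge0 // ler0n.
rewrite ler_weXn2l //; first by rewrite invf_ge1.
exact: (leq_bigmax_seq (F := fun w => weight (fmonom_val w))).
Qed.

(** On [Omega_n] the constant d = q^-n serves all points, so the rational truncations converge
    uniformly there. *)
Lemma Ehat_rigid (x : words p) : (0 < r)%N -> rigid_analytic (Ehat (M := M) (r := r) x).
Proof.
move=> r0 n n0; exists (fun N => Ehat_trunc N x); split.
  move=> N; apply: rational_sum => w.
  by apply: rationalM; [apply: rational_const | apply: rational_Eis_trunc].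
move=> e e0; pose d : R := q ^- n.
have d0 : 0 < d by rewrite invr_gt0 exprn_gt0 // q_gt0.
have d1 : d <= 1 by rewrite invf_le1 ?exprn_gt0 ?q_gt0 // exprn_ege1 // q_ge1.
have [N0 N0P] : exists N0, forall N, (N0 <= N)%N -> d^-1 ^+ max_weight x * q ^- N < e.
  by apply: qN_small => //; rewrite exprn_gt0 // invr_gt0.
exists N0 => N le_N z zn.
apply: le_lt_trans (Ehat_approx N x d0 d1 (Omega_n_lower_bound r0 zn)) _; exact: N0P.
Qed.

Lemma Ehat_lim (x : words p) (z : Omega M r) :
  seq_lim (@vC R F M) (fun N => Ehat_trunc N x z) (Ehat x z).
Proof.
have [d' d'0 d'P] := Omega_lower_bound z; pose d := Num.min 1 d'.
have d0 : 0 < d by rewrite lt_min ltr01.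
have d1 : d <= 1 by rewrite ge_min lexx.
have dP : lower_bound d z by apply: lower_boundW d'P; rewrite ge_min lexx orbT.
move=> e e0; have [N0 N0P] : exists N0, forall N, (N0 <= N)%N -> d^-1 ^+ max_weight x * q ^- N < e.
  by apply: qN_small => //; rewrite exprn_gt0 // invr_gt0.
exists N0 => N le_N; rewrite (absv_sub (@vC_absval R F M)).
by apply: le_lt_trans (Ehat_approx N x d0 d1 dP) _; apply: N0P.
Qed.

Lemma pchar_Cinf : p \in [pchar C].
Proof. by rewrite (fmorph_pchar (of_const M)). Qed.

(** True by computation, since F_p acts on [pPrimeCharType] through natural representatives; it
    makes the linearity of [wlin] available. *)
Lemma EhatE (x : words p) (z : Omega M r) :
  Ehat x z = wlin (fun w => Eis w z : pPrimeCharType pchar_Cinf) x.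
Proof. by []. Qed.

Lemma Ehat_truncE N (x : words p) (z : Omega M r) :
  Ehat_trunc N x z = Slt_words (trunc_phi N z) pchar_Cinf (r * N) x.
Proof. by []. Qed.

Lemma Ehat_xw (a : mindex) (z : Omega M r) : Ehat (xw p a) z = Eis a z.
Proof. exact: (wlin_xw (fun w => Eis w z : pPrimeCharType pchar_Cinf) a). Qed.

(** The truncations satisfy the identity exactly for every N, so both sides are limits of the same
    sequence. *)
Lemma Ehat_qshuffle (x y : words p) (z : Omega M r) :
  Ehat (qshuffle #|F| x y) z = Ehat x z * Ehat y z.
Proof.
apply: (seq_lim_unique (@vC_absval R F M) (Ehat_lim _ z)) => e e0.
have [N0 N0P] := seq_limM (@vC_absval R F M) (Ehat_lim x z) (Ehat_lim y z) e0.
exists N0 => N /N0P; rewrite !Ehat_truncE.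
have <- := Slt_words_qshuffle (@trunc_phiP R F M r N z) (@trunc_phi_neq0 R F M r N z)
  pchar_Cinf x y (leqnn (r * N)%N).
by [].
Qed.

End Ehat.

Theorem theorem1p6 (R : realType) (p : nat) (F : finFieldType)
    (hp : p \in [pchar F]) (M : Cinf_model R F) (r : nat) (hr : (0 < r)%N) :
  let q := #|F| in
  let E := @Eis R F M r in
  let hatE := @Ehat R F M r p in
  [/\ forall x : words p, rigid_analytic (hatE x),
      forall (c : 'F_p) (x y : words p) (z : Omega M r),
        hatE (c *: x + y) z = (c : nat)%:R * hatE x z + hatE y z,
      forall z : Omega M r, hatE 1 z = 1,
      forall (a : mindex) (z : Omega M r), a != [::] -> hatE (xw p a) z = E a z
    & (forall (x y : words p) (z : Omega M r),
         hatE (qshuffle q x y) z = hatE x z * hatE y z) /\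
      (forall (a b : mindex) (z : Omega M r),
         hatE (qshuffle q (xw p a) (xw p b)) z = E a z * E b z)].
Proof.
move=> q E hatE; split.
- by move=> x; apply: Ehat_rigid.
- move=> c x y z; rewrite /hatE !(EhatE hp).
  exact: (wlin_is_linear (fun w => Eis w z : pPrimeCharType (pchar_Cinf M hp)) c x y).
- by move=> z; rewrite /hatE -(xw0 p) (Ehat_xw hp).
- by move=> a z _; apply: Ehat_xw.
split=> [x y z|a b z]; first exact: Ehat_qshuffle.
by rewrite /hatE Ehat_qshuffle // !(Ehat_xw hp).
Qed.
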